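(* Let $\alpha>-1$, let $M>0$ be a constant, and let $f\in\mathcal{C}^2(\mathbb{D})$ be a solution of the Dirichlet problem $T_\alpha(f)=0$ in $\mathbb{D}$, $f=f^*$ on $\partial\mathbb{D}$ (in the distributional sense), with the series expansion $$f(z)=\sum_{k=0}^{\infty}c_kF\left(-\frac{\alpha}{2},k-\frac{\alpha}{2};k+1;|z|^2\right)z^k+\sum_{k=1}^{\infty}c_{-k}F\left(-\frac{\alpha}{2},k-\frac{\alpha}{2};k+1;|z|^2\right)\bar z^{\,k},\quad z\in\mathbb{D},$$ where $\{c_k\}_{k=-\infty}^{\infty}$ is a sequence of complex numbers with $\limsup_{|k|\to\infty}|c_k|^{1/|k|}\le1$, and suppose $\sup_{z\in\mathbb{D}}|f(z)|\le M$. Then, for every $k\in\{1,2,\ldots\}$, $$|c_k|+|c_{-k}|\le\frac{4M\,\Gamma\left(1+\frac{\alpha}{2}\right)\Gamma\left(k+1+\frac{\alpha}{2}\right)}{k!\,\Gamma(\alpha+1)\,\pi}.$$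
   Context: $\mathbb{D}$ is the open unit disk in $\mathbb{C}$; $\mathcal{C}^2(\mathbb{D})$ is the set of twice continuously differentiable complex-valued functions on $\mathbb{D}$. With $\frac{\partial}{\partial z}=\frac12(\frac{\partial}{\partial x}-i\frac{\partial}{\partial y})$, $\frac{\partial}{\partial\bar z}=\frac12(\frac{\partial}{\partial x}+i\frac{\partial}{\partial y})$ and $\Delta=4\frac{\partial^2}{\partial z\partial\bar z}$, for $\alpha\in\mathbb{R}$ the operator $T_\alpha$ is $$T_{\alpha}=-\frac{\alpha^{2}}{4}(1-|z|^{2})^{-\alpha-1}+\frac{\alpha}{2}(1-|z|^{2})^{-\alpha-1}\left(z\frac{\partial}{\partial z}+\bar z\frac{\partial}{\partial\bar z}\right)+\frac14(1-|z|^2)^{-\alpha}\Delta .$$ The Dirichlet problem means: $T_\alpha(f)=0$ in $\mathbb{D}$, and for a distribution $f^*\in\mathfrak{D}'(\partial\mathbb{D})$ the functions $f_r(e^{i\theta})=f(re^{i\theta})$, $r\in[0,1)$, converge to $f^*$ in $\mathfrak{D}'(\partial\mathbb{D})$ as $r\to1^-$. $\Gamma$ is the Gamma function. The hypergeometric function is $F(a,b;c;x)=\sum_{n=0}^\infty\frac{(a)_n(b)_n}{(c)_n}\frac{x^n}{n!}$ for $|x|<1$, with $(a)_0=1$, $(a)_n=a(a+1)\cdots(a+n-1)$. *)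

(* Defs.v *)
From Stdlib Require Import Reals ZArith.
From Coquelicot Require Export Coquelicot.
Open Scope R_scope.

Definition unit_disk (z : C) : Prop := Cmod z < 1.

Definition ex_CDerive (g : R -> C) (t : R) : Prop :=
  ex_derive (fun s => Re (g s)) t /\ ex_derive (fun s => Im (g s)) t.

Definition CDerive (g : R -> C) (t : R) : C :=
  (Derive (fun s => Re (g s)) t, Derive (fun s => Im (g s)) t).

Definition partial_x (f : C -> C) (z : C) : C :=
  CDerive (fun x => f (x, Im z)) (Re z).

Definition partial_y (f : C -> C) (z : C) : C :=
  CDerive (fun y => f (Re z, y)) (Im z).

(** [Cn_on D n f]: [f] is [n] times continuously differentiable (in the real
    sense) on [D].  Meant for an open [D] only: there, continuity at a point of
    [D] and the partial derivatives do not see the values of [f] outside [D]. *)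
Fixpoint Cn_on (D : C -> Prop) (n : nat) (f : C -> C) : Prop :=
  (forall z : C, D z -> continuous f z) /\
  match n with
  | O => True
  | S m =>
      (forall z : C, D z ->
         ex_CDerive (fun x => f (x, Im z)) (Re z) /\
         ex_CDerive (fun y => f (Re z, y)) (Im z)) /\
      Cn_on D m (partial_x f) /\ Cn_on D m (partial_y f)
  end.

Definition dz (f : C -> C) (z : C) : C :=
  (/ 2 * (partial_x f z - Ci * partial_y f z))%C.

Definition dzbar (f : C -> C) (z : C) : C :=
  (/ 2 * (partial_x f z + Ci * partial_y f z))%C.

Definition laplacian (f : C -> C) (z : C) : C := (4 * dz (dzbar f) z)%C.

Definition T_op (alpha : R) (f : C -> C) (z : C) : C :=
  (RtoC (- (alpha ^ 2 / 4) * Rpower (1 - Cmod z ^ 2) (- alpha - 1)) * f z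
   + RtoC (alpha / 2 * Rpower (1 - Cmod z ^ 2) (- alpha - 1))
     * (z * dz f z + Cconj z * dzbar f z)
   + RtoC (1 / 4 * Rpower (1 - Cmod z ^ 2) (- alpha)) * laplacian f z)%C.

(** A test function on the circle is identified with its lift
    [theta |-> phi (e^{i theta})], a smooth 2 pi-periodic function on [R]. *)
Definition test_function (phi : R -> C) : Prop :=
  (forall t : R, phi (t + 2 * PI) = phi t) /\
  (forall (n : nat) (t : R),
     ex_derive_n (fun s => Re (phi s)) n t /\
     ex_derive_n (fun s => Im (phi s)) n t).

Definition CDerive_n (phi : R -> C) (n : nat) (t : R) : C :=
  (Derive_n (fun s => Re (phi s)) n t, Derive_n (fun s => Im (phi s)) n t).

Definition sup_norm (g : R -> C) : R :=
  real (Lub_Rbar (fun x => exists t : R, x = Cmod (g t))).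

(** Continuity on the Frechet space of test functions, expressed by its
    defining seminorms.  Values off the test functions are irrelevant. *)
Record distribution := {
  pairing :> (R -> C) -> C;
  pairing_linear : forall (a b : C) (phi psi : R -> C),
    test_function phi -> test_function psi ->
    pairing (fun t => a * phi t + b * psi t)%C
      = (a * pairing phi + b * pairing psi)%C;
  pairing_continuous : exists (K : R) (N : nat), forall phi : R -> C,
    test_function phi ->
    Cmod (pairing phi)
      <= K * sum_n (fun j => sup_norm (CDerive_n phi j)) N }.

Definition Cexp_i (theta : R) : C := (cos theta, sin theta).

(** A continuous function [g] on the circle acts as a distribution through
    [phi |-> int_0^{2 pi} g (e^{i theta}) phi (e^{i theta}) d theta]. *)
Definition circle_pairing (g phi : R -> C) : C :=
  RInt (V := C_R_CompleteNormedModule) (fun theta => (g theta * phi theta)%C)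
    0 (2 * PI).

Definition boundary_values (f : C -> C) (fstar : distribution) : Prop :=
  forall phi : R -> C, test_function phi ->
    filterlim
      (fun r : R =>
         circle_pairing (fun theta => f (RtoC r * Cexp_i theta)%C) phi)
      (at_left 1) (locally (fstar phi)).

Definition Dirichlet_solution (alpha : R) (f : C -> C) (fstar : distribution)
  : Prop :=
  (forall z : C, unit_disk z -> T_op alpha f z = 0%C) /\
  boundary_values f fstar.

(** Euler's integral; this is the Gamma function for [s > 0] only. *)
Definition Gamma (s : R) : R :=
  RInt_gen (fun t => Rpower t (s - 1) * exp (- t))
    (at_right 0) (Rbar_locally p_infty).

Fixpoint pochhammer (a : R) (n : nat) : R :=
  match n with
  | O => 1
  | S m => pochhammer a m * (a + INR m)
  end.

Definition hypergeom (a b c x : R) : R :=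
  PSeries
    (fun n => pochhammer a n * pochhammer b n
              / (pochhammer c n * INR (fact n))) x.

Definition F_alpha (alpha : R) (k : nat) (z : C) : R :=
  hypergeom (- alpha / 2) (INR k - alpha / 2) (INR k + 1) (Cmod z ^ 2).

(** The expansion at [z], including the convergence of both series.  The second
    sum runs over [k >= 1], whence the shift by one. *)
Definition expansion_at (alpha : R) (c : Z -> C) (f : C -> C) (z : C) : Prop :=
  exists S1 S2 : C,
    is_series (K := C_AbsRing) (V := C_NormedModule)
      (fun k : nat =>
         (c (Z.of_nat k) * RtoC (F_alpha alpha k z) * Cpow z k)%C) S1 /\
    is_series (K := C_AbsRing) (V := C_NormedModule)
      (fun j : nat =>
         (c (- Z.of_nat (S j))%Z * RtoC (F_alpha alpha (S j) z)
          * Cpow (Cconj z) (S j))%C) S2 /\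
    f z = (S1 + S2)%C.

(** [x^(1/n)] for [x >= 0]; [Rpower 0 _] is 1, hence the case distinction. *)
Definition nth_root (n x : R) : R :=
  if Req_EM_T x 0 then 0 else Rpower x (/ n).

(** The upper limit of [u k] as [|k| -> infinity]. *)
Definition LimSup_Z (u : Z -> R) : Rbar :=
  Inf_seq (fun n : nat =>
    Lub_Rbar (fun x => exists k : Z, (Z.of_nat n <= Z.abs k)%Z /\ x = u k)).

(* Main.v *)
(** For fixed [r < 1] the series is the absolutely convergent Fourier series of
    [t |-> f (r e^(it))], with coefficients [c_(+-k) F_k(r^2) r^k].  Integrating the
    real part of a rotation of [f] against [cos (k t + p)], with rotation and [p] chosen
    to align the phases of the two coefficients, and using that [|cos (k t + p)|]
    integrates to 4 over a period, gives
    [(|c_k| + |c_(-k)|) |F_k(r^2)| r^k <= 4 M / PI].  Let [r -> 1]: the limit of [F_k]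
    is Gauss's value of the hypergeometric series at 1, which follows from the
    contiguous relation raising the third parameter by one together with Wendel's
    bounds on ratios of Gamma values. *)

Require Import Defs.
From Stdlib Require Import Reals ZArith.
From Coquelicot Require Import Coquelicot.
From Stdlib Require Import Lra Lia.
Open Scope R_scope.

(** * The Gamma function *)

(** Two steps need uniformity. On a circle of radius [r < 1] the factors [F_k(r^2)] must be bounded
    independently of [k], so that they cannot spoil the geometric decay of [c_k r^k]; a majorant
    series free of [k] gives this. Raabe's test yields it from [c - a - b = alpha + 1 > 0], which is
    where [alpha > -1] enters. For the same reason the estimate on a circle carries [|F_k(r^2)|];
    the absolute value disappears only in the limit, which is a positive quotient of Gamma values.
    The constant [4 / PI] is the quotient of the integral of [|cos (k t + p)|] by that of
    [cos (k t + p)^2] over a period, and Gauss's value contributes the reciprocal of the Gamma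
    factor in the bound. *)

Definition gamma_integrand (s t : R) : R := Rpower t (s - 1) * exp (- t).

(** The intervals increase and exhaust the half-line, so the two-sided improper integral becomes a
    limit along one monotone sequence of proper integrals; identities and inequalities for [Gamma]
    are proved for the truncations and passed to the limit. *)
Definition gamma_trunc (s : R) (n : nat) : R :=
  RInt (gamma_integrand s) (/ (INR n + 1)) (INR n + 1).

Lemma gamma_integrand_pos (s t : R) : 0 < gamma_integrand s t.
Proof. unfold gamma_integrand, Rpower. apply Rmult_lt_0_compat; apply exp_pos. Qed.

Lemma gamma_integrand_continuous (s t : R) :
  0 < t -> continuous (gamma_integrand s) t.
Proof.
  intros Ht. apply (ex_derive_continuous (K := R_AbsRing) (V := R_NormedModule)).
  unfold gamma_integrand, Rpower. auto_derive. auto.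
Qed.

Lemma exp_opp_le_1 (t : R) : 0 < t -> exp (- t) <= 1.
Proof. intros Ht. rewrite <- exp_0. apply Rlt_le, exp_increasing. lra. Qed.

Lemma ex_RInt_pos_continuous (g : R -> R) (a b : R) :
  (forall t, 0 < t -> continuous g t) -> 0 < a -> 0 < b -> ex_RInt g a b.
Proof.
  intros Hg Ha Hb. apply (ex_RInt_continuous (V := R_CompleteNormedModule)).
  intros t Ht. apply Hg. apply Rlt_le_trans with (2 := proj1 Ht).
  now apply Rmin_pos.
Qed.

Lemma ex_RInt_gamma_integrand (s a b : R) :
  0 < a -> 0 < b -> ex_RInt (gamma_integrand s) a b.
Proof.
  apply ex_RInt_pos_continuous. intros; now apply gamma_integrand_continuous.
Qed.

Lemma RInt_gamma_integrand_le (s a b a' b' : R) :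
  0 < a' -> a' <= a -> a <= b -> b <= b' ->
  RInt (gamma_integrand s) a b <= RInt (gamma_integrand s) a' b'.
Proof.
  intros Ha' Ha Hab Hb.
  assert (E : RInt (gamma_integrand s) a' b'
    = RInt (gamma_integrand s) a' a
      + (RInt (gamma_integrand s) a b + RInt (gamma_integrand s) b b')).
  { rewrite <- (RInt_Chasles (gamma_integrand s) a' a b') by
      (apply ex_RInt_gamma_integrand; lra).
    rewrite <- (RInt_Chasles (gamma_integrand s) a b b') by
      (apply ex_RInt_gamma_integrand; lra).
    reflexivity. }
  assert (P : forall u v, 0 < u -> u <= v -> 0 <= RInt (gamma_integrand s) u v).
  { intros u v Hu Huv. apply RInt_ge_0; auto.
    - apply ex_RInt_gamma_integrand; lra.
    - intros; apply Rlt_le, gamma_integrand_pos. }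
  assert (H1 := P a' a ltac:(lra) ltac:(lra)).
  assert (H2 := P b b' ltac:(lra) ltac:(lra)).
  lra.
Qed.

(** The maximum of [t^p exp(-t)] is at [t = p]; the inequality [ln u <= u - 1] at [u = t / p] gives
    it, and the extra factor [exp(-p)] is dropped. *)
Lemma Rpower_exp_bound (p t : R) :
  0 < p -> 0 < t -> Rpower t p * exp (- t) <= Rpower p p.
Proof.
  intros Hp Ht. unfold Rpower. rewrite <- exp_plus.
  assert (H : ln (t / p) <= t / p - 1).
  { assert (0 < t / p) by (apply Rdiv_lt_0_compat; lra).
    assert (X := exp_ineq1_le (ln (t / p))). rewrite exp_ln in X by assumption. lra. }
  unfold Rdiv in H at 1. rewrite ln_mult, ln_Rinv in H
    by (try apply Rinv_0_lt_compat; lra).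
  assert (H' : p * (ln t + - ln p) <= p * (t / p - 1)) by (apply Rmult_le_compat_l; lra).
  replace (p * (t / p - 1)) with (t - p) in H' by (field; lra).
  destruct (Rle_lt_or_eq_dec (p * ln t + - t) (p * ln p)) as [L | L].
  - lra.
  - apply Rlt_le, exp_increasing; lra.
  - rewrite L; apply Rle_refl.
Qed.

(* [t^(s-1) exp(-t)] is dominated by the derivative of the bounded function
   [-K / (s (1 + t^s))]. *)
Lemma RInt_gamma_integrand_bounded (s : R) : 0 < s ->
  exists B, forall a b, 0 < a -> a <= b -> RInt (gamma_integrand s) a b <= B.
Proof.
  intros Hs.
  (* Since [(1 + u)^2 <= 2 (1 + u^2)] with [u = t^s], the product [exp(-t) (1 + t^s)^2] is at most
     [2 exp(-t) + 2 t^(2 s) exp(-t)], and [Rpower_exp_bound] with [p = 2 s] bounds the second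
     term. *)
  set (K := 2 + 2 * Rpower (2 * s) (2 * s)).
  assert (HK : 0 < K).
  { unfold K. assert (H := exp_pos (2 * s * ln (2 * s))).
    fold (Rpower (2 * s) (2 * s)) in H. lra. }
  exists (K / s). intros a b Ha Hab.
  set (F := fun t => - (K / s) / (1 + Rpower t s)).
  set (dF := fun t => K * Rpower t (s - 1) / (1 + Rpower t s) ^ 2).
  assert (Hp : forall t, 0 < Rpower t s) by (intros t; apply exp_pos).
  assert (HF : forall t, 0 < t -> is_derive F t (dF t)).
  { intros t Ht. unfold F, dF.
    assert (P := Hp t).
    replace (Rpower t (s - 1)) with (Rpower t s * / t).
    2:{ unfold Rminus. rewrite Rpower_plus, Rpower_Ropp, Rpower_1; auto. }
    unfold Rpower in *. auto_derive.
    - split; auto. split; auto. lra.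
    - field. split; [|split]; lra. }
  assert (HI : is_RInt dF a b (minus (F b) (F a))).
  { apply (is_RInt_derive (V := R_CompleteNormedModule));
      rewrite Rmin_left, Rmax_right by lra; intros t Ht.
    - apply HF; lra.
    - apply (ex_derive_continuous (K := R_AbsRing) (V := R_NormedModule)).
      unfold dF, Rpower. assert (P := Hp t). unfold Rpower in P.
      auto_derive. repeat split; try lra.
      apply Rmult_integral_contrapositive; split; lra. }
  apply Rle_trans with (RInt dF a b).
  - apply RInt_le; auto.
    + apply ex_RInt_gamma_integrand; lra.
    + eexists; apply HI.
    + intros t Ht. unfold gamma_integrand, dF.
      assert (Ht0 : 0 < t) by lra.
      assert (P := Hp t).
      assert (E := Rpower_exp_bound (2 * s) t ltac:(lra) Ht0).
      assert (E1 := exp_opp_le_1 t ltac:(lra)).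
      assert (E2 : Rpower t (2 * s) = Rpower t s ^ 2).
      { replace (2 * s) with (s + s) by ring. rewrite Rpower_plus. ring. }
      rewrite E2 in E.
      assert (E3 : exp (- t) * (1 + Rpower t s) ^ 2 <= K).
      { unfold K. assert (X := exp_pos (- t)).
        assert (exp (- t) * (1 - Rpower t s) ^ 2 >= 0)
          by (apply Rle_ge, Rmult_le_pos; [lra | apply pow2_ge_0]).
        lra. }
      assert (Q : 0 < Rpower t (s - 1)) by apply exp_pos.
      apply Rmult_le_reg_r with ((1 + Rpower t s) ^ 2).
      { apply pow_lt; lra. }
      replace (K * Rpower t (s - 1) / (1 + Rpower t s) ^ 2 * (1 + Rpower t s) ^ 2)
        with (Rpower t (s - 1) * K) by (field; lra).
      rewrite Rmult_assoc. apply Rmult_le_compat_l; lra.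
  - rewrite (is_RInt_unique _ _ _ _ HI). unfold minus, plus, opp; simpl. unfold F.
    assert (0 < K / s) by (apply Rdiv_lt_0_compat; lra).
    assert (P := Hp b). assert (P' := Hp a).
    assert (0 <= K / s / (1 + Rpower b s))
      by (apply Rlt_le, Rdiv_lt_0_compat; lra).
    assert (K / s / (1 + Rpower a s) <= K / s).
    { apply Rmult_le_reg_r with (1 + Rpower a s); [lra|].
      unfold Rdiv at 1. rewrite Rmult_assoc, Rinv_l by lra.
      apply Rmult_le_compat_l; lra. }
    replace (- (K / s) / (1 + Rpower b s)) with (- (K / s / (1 + Rpower b s)))
      by (unfold Rdiv; ring).
    replace (- (- (K / s) / (1 + Rpower a s))) with (K / s / (1 + Rpower a s))
      by (unfold Rdiv; ring).
    lra.
Qed.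

Lemma gamma_trunc_bounds (n : nat) :
  0 < / (INR n + 1) /\ / (INR n + 1) <= 1 /\ 1 <= INR n + 1.
Proof.
  assert (H := pos_INR n). split; [|split].
  - apply Rinv_0_lt_compat; lra.
  - rewrite <- Rinv_1. apply Rinv_le_contravar; lra.
  - lra.
Qed.

Lemma gamma_trunc_incr (s : R) (n : nat) : gamma_trunc s n <= gamma_trunc s (S n).
Proof.
  unfold gamma_trunc. assert (H1 := gamma_trunc_bounds n).
  assert (H2 := gamma_trunc_bounds (S n)).
  assert (H := pos_INR n). rewrite S_INR in *.
  apply RInt_gamma_integrand_le; try lra.
  apply Rinv_le_contravar; lra.
Qed.

(** Monotonicity and boundedness give a limit [l]. It is the improper integral because the integrand
    is positive: an integral over any interval containing the [N]-th one lies between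
    [gamma_trunc s N] and [l], the upper bound coming from a still larger truncation. *)
Lemma gamma_trunc_lim (s : R) : 0 < s -> is_lim_seq (gamma_trunc s) (Gamma s).
Proof.
  intros Hs.
  destruct (RInt_gamma_integrand_bounded s Hs) as [B HB].
  destruct (ex_finite_lim_seq_incr (gamma_trunc s) B) as [l Hl].
  { apply gamma_trunc_incr. }
  { intros n. apply HB; assert (H := gamma_trunc_bounds n); lra. }
  assert (HG : Gamma s = l).
  { unfold Gamma. apply is_RInt_gen_unique.
    intros P [eps HP].
    destruct (proj2 (is_lim_seq_spec _ _) Hl eps) as [N HN].
    specialize (HN N (le_n N)).
    assert (HNl := is_lim_seq_incr_compare _ _ Hl (gamma_trunc_incr s)).
    assert (HbN := gamma_trunc_bounds N).
    apply (Filter_prod _ _ _ (fun a => 0 < a < / (INR N + 1))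
             (fun b => INR N + 1 < b)).
    - exists (mkposreal _ (proj1 HbN)). intros y Hy Hy0.
      unfold ball in Hy; simpl in Hy. unfold AbsRing_ball, abs, minus, plus, opp in Hy;
        simpl in Hy.
      split; auto. apply Rabs_def2 in Hy. lra.
    - exists (INR N + 1). auto.
    - intros a b Ha Hb. simpl.
      exists (RInt (gamma_integrand s) a b). split.
      + apply (RInt_correct (V := R_CompleteNormedModule)).
        apply (ex_RInt_gamma_integrand s a b); lra.
      + apply HP. unfold ball; simpl.
        unfold AbsRing_ball, abs, minus, plus, opp; simpl.
        assert (L1 : gamma_trunc s N <= RInt (gamma_integrand s) a b)
          by (apply RInt_gamma_integrand_le; lra).
        assert (L2 : RInt (gamma_integrand s) a b <= l).
        { destruct (INR_unbounded (b + / a)) as [m Hm].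
          apply Rle_trans with (2 := HNl m).
          assert (0 < / a) by (apply Rinv_0_lt_compat; lra).
          apply RInt_gamma_integrand_le; try lra.
          - apply gamma_trunc_bounds.
          - rewrite <- (Rinv_inv a). apply Rinv_le_contravar; lra. }
        apply Rabs_def2 in HN. apply Rabs_def1; destruct eps; simpl in *; lra. }
  rewrite HG; exact Hl.
Qed.

Lemma Gamma_pos (s : R) : 0 < s -> 0 < Gamma s.
Proof.
  intros Hs.
  apply Rlt_le_trans with (gamma_trunc s 1).
  - unfold gamma_trunc. simpl. apply RInt_gt_0.
    + lra.
    + intros; apply gamma_integrand_pos.
    + intros t Ht. apply gamma_integrand_continuous. lra.
  - apply is_lim_seq_incr_compare; [now apply gamma_trunc_lim | apply gamma_trunc_incr].
Qed.

Lemma Rpower_INR_lim_0 (s : R) : 0 < s ->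
  is_lim_seq (fun n => Rpower (INR n + 1) (- s)) 0.
Proof.
  intros Hs. unfold Rpower.
  apply (is_lim_seq_le_le_loc (fun _ => 0) _ (fun n => / (1 + s * ln (INR n + 1)))).
  - exists O. intros n _. split; [apply Rlt_le, exp_pos|].
    assert (Hl : 0 <= ln (INR n + 1)).
    { rewrite <- ln_1. assert (H := pos_INR n).
      destruct (Rle_lt_or_eq_dec 1 (INR n + 1)) as [L|L]; [lra| |rewrite <- L; lra].
      apply Rlt_le, ln_increasing; lra. }
    assert (Hsl : 0 <= s * ln (INR n + 1)) by (apply Rmult_le_pos; lra).
    rewrite <- Ropp_mult_distr_l, exp_Ropp. apply Rinv_le_contravar; [lra|].
    apply exp_ineq1_le.
  - apply is_lim_seq_const.
  - replace (Finite 0) with (Rbar_inv p_infty) by reflexivity.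
    apply is_lim_seq_inv; [|discriminate].
    apply (is_lim_seq_plus _ _ 1 p_infty); [apply is_lim_seq_const| |reflexivity].
    replace p_infty with (Rbar_mult s p_infty).
    2:{ simpl. destruct (Rle_dec 0 s) as [L|L]; [|lra].
        destruct (Rle_lt_or_eq_dec 0 s L); [reflexivity|lra]. }
    apply is_lim_seq_scal_l.
    apply (is_lim_comp_seq ln (fun n => INR n + 1) p_infty p_infty).
    + apply is_lim_ln_p.
    + exists O. intros; discriminate.
    + apply (is_lim_seq_plus _ _ p_infty 1);
        [apply is_lim_seq_INR | apply is_lim_seq_const | reflexivity].
Qed.

(** Integration by parts on a truncated interval: [gamma_integrand (s + 1)] is [t^s exp(-t)], whose
    derivative is [dG]. The boundary terms are kept exactly. *)
Lemma gamma_trunc_succ (s : R) (n : nat) :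
  gamma_trunc (s + 1) n = s * gamma_trunc s n
    - (gamma_integrand (s + 1) (INR n + 1) - gamma_integrand (s + 1) (/ (INR n + 1))).
Proof.
  assert (B := gamma_trunc_bounds n).
  set (dG := fun t => s * gamma_integrand s t - gamma_integrand (s + 1) t).
  assert (HI : is_RInt dG (/ (INR n + 1)) (INR n + 1)
     (minus (gamma_integrand (s + 1) (INR n + 1))
            (gamma_integrand (s + 1) (/ (INR n + 1))))).
  { apply (is_RInt_derive (V := R_CompleteNormedModule));
      rewrite Rmin_left, Rmax_right by lra; intros t Ht.
    - unfold dG, gamma_integrand. replace (s + 1 - 1) with s by ring.
      replace (Rpower t (s - 1)) with (Rpower t s * / t).
      2:{ unfold Rminus. rewrite Rpower_plus, Rpower_Ropp, Rpower_1; lra. }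
      unfold Rpower. auto_derive; [lra|]. field. lra.
    - unfold dG. apply (continuous_minus (V := R_NormedModule)).
      + apply (continuous_scal_r (K := R_AbsRing) (V := R_NormedModule) s).
        apply gamma_integrand_continuous; lra.
      + apply gamma_integrand_continuous; lra. }
  assert (HI' := is_RInt_unique _ _ _ _ HI).
  assert (E : RInt dG (/ (INR n + 1)) (INR n + 1)
      = s * gamma_trunc s n - gamma_trunc (s + 1) n).
  { unfold dG, gamma_trunc.
    assert (E1 : ex_RInt (gamma_integrand s) (/ (INR n + 1)) (INR n + 1))
      by (apply ex_RInt_gamma_integrand; lra).
    assert (E2 : ex_RInt (gamma_integrand (s + 1)) (/ (INR n + 1)) (INR n + 1))
      by (apply ex_RInt_gamma_integrand; lra).
    apply is_RInt_unique.
    apply (is_RInt_minus (V := R_NormedModule)).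
    - apply (is_RInt_scal (V := R_NormedModule)).
      now apply (RInt_correct (V := R_CompleteNormedModule)).
    - now apply (RInt_correct (V := R_CompleteNormedModule)). }
  rewrite HI' in E. unfold minus, plus, opp in E; simpl in E. lra.
Qed.

Lemma Gamma_succ (s : R) : 0 < s -> Gamma (s + 1) = s * Gamma s.
Proof.
  intros Hs.
  assert (H1 := gamma_trunc_lim (s + 1) ltac:(lra)).
  assert (H2 : is_lim_seq (gamma_trunc (s + 1)) (s * Gamma s - (0 - 0))).
  { apply (is_lim_seq_ext _ _ _ (fun n => eq_sym (gamma_trunc_succ s n))).
    apply is_lim_seq_minus'; [|apply is_lim_seq_minus'].
    - apply (is_lim_seq_scal_l _ s (Gamma s)). now apply gamma_trunc_lim.
    (* The upper boundary term is the bounded quantity [t^(s+1) exp(-t)] times [1 / t] at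
       [t = n + 1]; the lower one, treated next, is at most [(n + 1)^(-s)]. *)
    - apply (is_lim_seq_le_le (fun _ => 0) _
               (fun n => Rpower (s + 1) (s + 1) * Rpower (INR n + 1) (- 1))).
      + intros n. assert (B := gamma_trunc_bounds n).
        split; [apply Rlt_le, gamma_integrand_pos|].
        unfold gamma_integrand.
        replace (s + 1 - 1) with ((s + 1) + - 1) at 1 by ring.
        rewrite Rpower_plus.
        assert (X := Rpower_exp_bound (s + 1) (INR n + 1) ltac:(lra) ltac:(lra)).
        assert (0 < Rpower (INR n + 1) (- 1)) by apply exp_pos.
        apply (Rmult_le_compat_r (Rpower (INR n + 1) (- 1))) in X; lra.
      + apply is_lim_seq_const.
      + replace (Finite 0) with (Finite (Rpower (s + 1) (s + 1) * 0))
          by (f_equal; apply Rmult_0_r).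
        apply (is_lim_seq_scal_l _ _ 0). exact (Rpower_INR_lim_0 1 Rlt_0_1).
    - apply (is_lim_seq_le_le (fun _ => 0) _ (fun n => Rpower (INR n + 1) (- s))).
      + intros n. assert (B := gamma_trunc_bounds n).
        split; [apply Rlt_le, gamma_integrand_pos|].
        unfold gamma_integrand. replace (s + 1 - 1) with s by ring.
        rewrite Rpower_Ropp. unfold Rpower. rewrite ln_Rinv by lra.
        rewrite <- exp_Ropp.
        replace (s * - ln (INR n + 1)) with (- (s * ln (INR n + 1))) by ring.
        rewrite <- (Rmult_1_r (exp (- (s * _)))) at 2.
        apply Rmult_le_compat_l; [apply Rlt_le, exp_pos|].
        apply exp_opp_le_1. lra.
      + apply is_lim_seq_const.
      + now apply Rpower_INR_lim_0. }
  assert (E := is_lim_seq_unique _ _ H1). rewrite (is_lim_seq_unique _ _ H2) in E.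
  injection E as E. lra.
Qed.

Lemma Gamma_1 : Gamma 1 = 1.
Proof.
  assert (H1 := gamma_trunc_lim 1 ltac:(lra)).
  assert (HI : forall n, gamma_trunc 1 n = exp (- / (INR n + 1)) - exp (- (INR n + 1))).
  { intros n. unfold gamma_trunc. assert (B := gamma_trunc_bounds n).
    apply is_RInt_unique.
    replace (exp (- / (INR n + 1)) - exp (- (INR n + 1)))
      with (minus (- exp (- (INR n + 1))) (- exp (- / (INR n + 1))))
      by (unfold minus, plus, opp; simpl; ring).
    apply (is_RInt_derive (V := R_CompleteNormedModule) (fun t => - exp (- t)));
      rewrite Rmin_left, Rmax_right by lra; intros t Ht.
    - unfold gamma_integrand. rewrite Rminus_diag, Rpower_O by lra.
      auto_derive; auto. ring.
    - apply gamma_integrand_continuous; lra. }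
  assert (H2 : is_lim_seq (gamma_trunc 1) (exp (- 0) - 0)).
  { apply (is_lim_seq_ext _ _ _ (fun n => eq_sym (HI n))).
    assert (Hinf : is_lim_seq (fun n => INR n + 1) p_infty).
    { apply (is_lim_seq_plus _ _ p_infty 1);
        [apply is_lim_seq_INR | apply is_lim_seq_const | reflexivity]. }
    apply is_lim_seq_minus'.
    - apply (is_lim_seq_continuous (fun x => exp (- x))).
      + apply derivable_continuous_pt. reg.
      + apply (is_lim_seq_inv _ p_infty); [exact Hinf | discriminate].
    - apply (is_lim_comp_seq exp (fun n => - (INR n + 1)) m_infty 0).
      + apply is_lim_exp_m.
      + exists O. intros; discriminate.
      + apply (is_lim_seq_opp _ p_infty). exact Hinf. }
  assert (E := is_lim_seq_unique _ _ H1). rewrite (is_lim_seq_unique _ _ H2) in E.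
  injection E as E. rewrite Ropp_0, exp_0 in E. lra.
Qed.

Lemma Gamma_fact (n : nat) : Gamma (INR n + 1) = INR (fact n).
Proof.
  induction n as [|n IH].
  - simpl. rewrite Rplus_0_l. apply Gamma_1.
  - rewrite S_INR, Gamma_succ, IH by (assert (H := pos_INR n); lra).
    rewrite fact_simpl, mult_INR, S_INR. reflexivity.
Qed.

(** The bound [1 + u <= exp u] is used at [u = (1 - s) L] and [u = - s L], [L = ln y], with weights
    [s] and [1 - s]: the linear terms cancel, and multiplying by [exp (s L)] gives the claim. *)
Lemma weighted_amgm (s y : R) : 0 <= s <= 1 -> 0 < y ->
  Rpower y s <= 1 - s + s * y.
Proof.
  intros Hs Hy. unfold Rpower. rewrite <- (exp_ln y) at 2 by assumption.
  set (L := ln y).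
  assert (H1 := exp_ineq1_le ((1 - s) * L)). assert (H2 := exp_ineq1_le (- (s * L))).
  assert (P := exp_pos (s * L)).
  assert (E1 : exp L = exp (s * L) * exp ((1 - s) * L))
    by (rewrite <- exp_plus; f_equal; ring).
  assert (E2 : 1 = exp (s * L) * exp (- (s * L)))
    by (rewrite <- exp_plus, Rplus_opp_r, exp_0; reflexivity).
  rewrite E1.
  assert (s * (1 + (1 - s) * L) + (1 - s) * (1 + - (s * L))
          <= s * exp ((1 - s) * L) + (1 - s) * exp (- (s * L))).
  { apply Rplus_le_compat; apply Rmult_le_compat_l; lra. }
  assert (X : exp (s * L) * 1 <= exp (s * L) *
            (s * exp ((1 - s) * L) + (1 - s) * exp (- (s * L)))).
  { apply Rmult_le_compat_l; [apply Rlt_le, P|].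
    apply Rle_trans with (2 := H). apply Req_le. ring. }
  assert (E3 : (1 - s) * 1 = (1 - s) * (exp (s * L) * exp (- (s * L))))
    by (rewrite <- E2; reflexivity).
  lra.
Qed.

(* Wendel's inequality: integrate the tangent-line bound of the concave function
   [t^s] at [t = x] against [t^(x-1) exp(-t)]. *)
Lemma Gamma_add_le (x s : R) : 0 < x -> 0 <= s <= 1 ->
  Gamma (x + s) <= Rpower x s * Gamma x.
Proof.
  intros Hx Hs.
  assert (Hn : forall n, gamma_trunc (x + s) n <=
     Rpower x s * (1 - s) * gamma_trunc x n
     + Rpower x s * s / x * gamma_trunc (x + 1) n).
  { intros n. assert (B := gamma_trunc_bounds n). unfold gamma_trunc.
    set (h := fun t => Rpower x s * (1 - s) * gamma_integrand x t
                  + Rpower x s * s / x * gamma_integrand (x + 1) t).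
    assert (HI : is_RInt h (/ (INR n + 1)) (INR n + 1)
      (Rpower x s * (1 - s) * RInt (gamma_integrand x) (/ (INR n + 1)) (INR n + 1)
       + Rpower x s * s / x * RInt (gamma_integrand (x + 1)) (/ (INR n + 1)) (INR n + 1))).
    { apply (is_RInt_plus (V := R_NormedModule));
        apply (is_RInt_scal (V := R_NormedModule));
        apply (RInt_correct (V := R_CompleteNormedModule));
        apply ex_RInt_gamma_integrand; lra. }
    rewrite <- (is_RInt_unique _ _ _ _ HI).
    apply RInt_le; [lra | apply ex_RInt_gamma_integrand; lra | eexists; apply HI |].
    intros t Ht. unfold h, gamma_integrand.
    assert (T0 : 0 < t) by lra.
    replace (x + s - 1) with ((x - 1) + s) by ring.
    replace (x + 1 - 1) with ((x - 1) + 1) by ring.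
    rewrite !Rpower_plus, Rpower_1 by assumption.
    replace (Rpower t s) with (Rpower x s * Rpower (t / x) s).
    2:{ rewrite Rpower_mult_distr by (try apply Rdiv_lt_0_compat; assumption).
        f_equal. field. lra. }
    assert (W := weighted_amgm s (t / x) Hs ltac:(apply Rdiv_lt_0_compat; assumption)).
    assert (0 < Rpower x s * Rpower t (x - 1) * exp (- t)).
    { unfold Rpower. repeat apply Rmult_lt_0_compat; apply exp_pos. }
    apply (Rmult_le_compat_l (Rpower x s * Rpower t (x - 1) * exp (- t))) in W; [|lra].
    unfold Rdiv in *. lra. }
  assert (L := is_lim_seq_le _ _ (Gamma (x + s))
    (Rpower x s * (1 - s) * Gamma x + Rpower x s * s / x * Gamma (x + 1)) Hn).
  simpl in L. rewrite Gamma_succ in L by assumption.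
  replace (Rpower x s * Gamma x) with
    (Rpower x s * (1 - s) * Gamma x + Rpower x s * s / x * (x * Gamma x)) by (field; lra).
  rewrite <- Gamma_succ in * by assumption.
  apply L.
  - apply gamma_trunc_lim; lra.
  - apply is_lim_seq_plus'.
    + apply (is_lim_seq_scal_l _ _ (Gamma x)), gamma_trunc_lim; lra.
    + apply (is_lim_seq_scal_l _ _ (Gamma (x + 1))), gamma_trunc_lim; lra.
Qed.

(** * Asymptotics of ratios of Gamma values *)

Lemma pochhammer_Gamma (x : R) (n : nat) : 0 < x ->
  Gamma (x + INR n) = pochhammer x n * Gamma x.
Proof.
  intros Hx. induction n as [|n IH].
  - simpl. rewrite Rplus_0_r; ring.
  - rewrite S_INR, <- Rplus_assoc, Gamma_succ, IH by (assert (H := pos_INR n); lra).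
    simpl. ring.
Qed.

(** With [N = n + 1] this is [Gamma (x + N) / (Gamma N * N^x)]; the shift keeps the base of the
    power and the argument of [Gamma] positive at [n = 0]. *)
Definition gamma_ratio (x : R) (n : nat) : R :=
  Gamma (x + (INR n + 1)) / (Gamma (INR n + 1) * Rpower (INR n + 1) x).

Lemma is_lim_seq_shift_div (x : R) :
  is_lim_seq (fun n => 1 + x * / (INR n + 1)) 1.
Proof.
  replace (Finite 1) with (Finite (1 + x * 0)) by (f_equal; ring).
  apply is_lim_seq_plus'; [apply is_lim_seq_const|].
  apply (is_lim_seq_scal_l _ x 0).
  apply (is_lim_seq_inv _ p_infty); [|discriminate].
  apply (is_lim_seq_plus _ _ p_infty 1);
    [apply is_lim_seq_INR | apply is_lim_seq_const | reflexivity].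
Qed.

(** The upper bound 1 is [Gamma_add_le] from [N] to [N + x]. The lower bound uses it from [N + x] to
    [N + 1]: then [N Gamma N <= (N + x)^(1 - x) Gamma (N + x)], and
    [(N + x)^(1 - x) <= (N + x) N^(-x)] leaves the ratio at least [N / (N + x)]. *)
Lemma gamma_ratio_lim_unit (x : R) : 0 <= x <= 1 ->
  is_lim_seq (gamma_ratio x) 1.
Proof.
  intros Hx.
  apply (is_lim_seq_le_le (fun n => / (1 + x * / (INR n + 1))) _ (fun _ => 1)).
  - intros n. assert (B := gamma_trunc_bounds n).
    set (N := INR n + 1) in *. assert (HN : 0 < N) by lra.
    assert (G := Gamma_pos N HN).
    assert (P : 0 < Rpower N x) by apply exp_pos.
    unfold gamma_ratio. fold N.
    assert (D : 0 < Gamma N * Rpower N x) by now apply Rmult_lt_0_compat.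
    split.
    + assert (H := Gamma_add_le (N + x) (1 - x) ltac:(lra) ltac:(lra)).
      replace (N + x + (1 - x)) with (N + 1) in H by ring.
      rewrite Gamma_succ in H by lra.
      rewrite (Rplus_comm x N). set (g := Gamma (N + x)) in *.
      assert (Hg : 0 < g) by (apply Gamma_pos; lra).
      assert (H' : Rpower (N + x) (1 - x) <= (N + x) * / Rpower N x).
      { unfold Rminus. rewrite Rpower_plus, Rpower_1, Rpower_Ropp by lra.
        apply Rmult_le_compat_l; [lra|]. apply Rinv_le_contravar; [assumption|].
        apply Rle_Rpower_l; lra. }
      apply Rmult_le_reg_r with ((1 + x * / N) * (Gamma N * Rpower N x)).
      { apply Rmult_lt_0_compat; [|assumption].
        assert (0 <= x * / N) by (apply Rmult_le_pos; lra). lra. }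
      apply Rmult_le_reg_r with (N * / Rpower N x).
      { apply Rmult_lt_0_compat; [lra | now apply Rinv_0_lt_compat]. }
      assert (Hxn : 0 < N + x) by lra.
      replace (/ (1 + x * / N) * ((1 + x * / N) * (Gamma N * Rpower N x)) * (N * / Rpower N x))
        with (N * Gamma N) by (field; repeat split; lra).
      replace (g / (Gamma N * Rpower N x) * ((1 + x * / N) * (Gamma N * Rpower N x)) *
        (N * / Rpower N x)) with ((N + x) * / Rpower N x * g) by (field; repeat split; lra).
      apply Rle_trans with (1 := H). apply Rmult_le_compat_r; lra.
    + rewrite (Rplus_comm x N).
      apply Rmult_le_reg_r with (Gamma N * Rpower N x); [assumption|].
      replace (Gamma (N + x) / (Gamma N * Rpower N x) * (Gamma N * Rpower N x))
        with (Gamma (N + x)) by (field; split; lra).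
      rewrite Rmult_1_l, Rmult_comm. apply Gamma_add_le; lra.
  - replace (Finite 1) with (Rbar_inv 1) by (simpl; f_equal; field).
    apply is_lim_seq_inv; [apply is_lim_seq_shift_div|].
    simpl. intros H; injection H; lra.
  - apply is_lim_seq_const.
Qed.

(** Wendel's bounds cover increments up to 1 only. The functional equation multiplies the ratio at
    [x - 1] by [1 + (x - 1) / N], which tends to 1, so induction on an integer above [x] reaches
    every increment. *)
Lemma gamma_ratio_lim (x : R) : 0 <= x -> is_lim_seq (gamma_ratio x) 1.
Proof.
  intros Hx.
  destruct (INR_unbounded x) as [m Hm].
  assert (Hm' : x <= INR m + 1) by lra. clear Hm. revert x Hx Hm'.
  induction m as [|m IH]; intros x Hx Hm.
  - apply gamma_ratio_lim_unit. simpl in Hm; lra.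
  - destruct (Rle_lt_dec x 1) as [L|L]; [apply gamma_ratio_lim_unit; lra|].
    rewrite S_INR in Hm.
    apply (is_lim_seq_ext
      (fun n => (1 + (x - 1) * / (INR n + 1)) * gamma_ratio (x - 1) n)).
    + intros n. unfold gamma_ratio. assert (H := pos_INR n).
      replace (x + (INR n + 1)) with ((x - 1 + (INR n + 1)) + 1) by ring.
      rewrite (Gamma_succ (x - 1 + (INR n + 1))) by lra.
      replace (Rpower (INR n + 1) x) with (Rpower (INR n + 1) ((x - 1) + 1))
        by (f_equal; ring).
      rewrite Rpower_plus, Rpower_1 by lra.
      assert (G := Gamma_pos (INR n + 1) ltac:(lra)).
      assert (P : 0 < Rpower (INR n + 1) (x - 1)) by apply exp_pos.
      field. repeat split; lra.
    + replace (Finite 1) with (Finite (1 * 1)) by (f_equal; ring).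
      apply is_lim_seq_mult'; [apply is_lim_seq_shift_div|].
      apply IH; lra.
Qed.

(* [N^(c-a) N^(c-b) = N^c N^(c-a-b)], so the powers cancel and each remaining
   factor [Gamma (x+N) / (Gamma N N^x)] tends to 1. *)
Lemma pochhammer_product_lim (a b c : R) :
  0 < c -> 0 < c - a -> 0 < c - b -> 0 < c - a - b ->
  is_lim_seq (fun n => pochhammer (c - a) (S n) * pochhammer (c - b) (S n)
                 / (pochhammer c (S n) * pochhammer (c - a - b) (S n)))
    (Gamma c * Gamma (c - a - b) / (Gamma (c - a) * Gamma (c - b))).
Proof.
  intros Hc Ha Hb Hab.
  assert (Gc := Gamma_pos c Hc). assert (Ga := Gamma_pos _ Ha).
  assert (Gb := Gamma_pos _ Hb). assert (Gab := Gamma_pos _ Hab).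
  set (K := Gamma c * Gamma (c - a - b) / (Gamma (c - a) * Gamma (c - b))).
  apply (is_lim_seq_ext (fun n => K * (gamma_ratio (c - a) n * gamma_ratio (c - b) n
                 / (gamma_ratio c n * gamma_ratio (c - a - b) n)))).
  - intros n. unfold gamma_ratio. rewrite <- S_INR.
    assert (HN : 0 < INR (S n)) by (apply lt_0_INR; lia).
    assert (GN := Gamma_pos _ HN).
    assert (P : forall y, 0 < y -> 0 < pochhammer y (S n)).
    { intros y Hy. assert (Gy := Gamma_pos _ Hy).
      assert (Gy' := Gamma_pos (y + INR (S n)) ltac:(lra)).
      rewrite (pochhammer_Gamma y (S n) Hy) in Gy'.
      apply Rmult_lt_reg_r with (Gamma y); lra. }
    assert (Q : forall y, 0 < Rpower (INR (S n)) y) by (intros; apply exp_pos).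
    rewrite !pochhammer_Gamma by lra.
    assert (Pc := P c Hc). assert (Pa := P _ Ha). assert (Pb := P _ Hb).
    assert (Pab := P _ Hab).
    assert (Qb := Q (c - b)). assert (Qab := Q (c - a - b)). assert (Qa := Q a).
    replace (Rpower (INR (S n)) c) with (Rpower (INR (S n)) ((c - a) + a))
      by (f_equal; ring).
    replace (Rpower (INR (S n)) (c - b)) with (Rpower (INR (S n)) ((c - a - b) + a))
      by (f_equal; ring).
    rewrite !Rpower_plus. assert (Qca := Q (c - a)).
    unfold K. field. repeat split; lra.
  - replace (Finite K) with (Finite (K * (1 * 1 / (1 * 1)))) by (f_equal; field).
    apply (is_lim_seq_scal_l _ K (1 * 1 / (1 * 1))).
    apply is_lim_seq_div'; [| |rewrite Rmult_1_l; apply R1_neq_R0]; apply is_lim_seq_mult'; apply gamma_ratio_lim; lra.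
Qed.

(** * Gauss's summation theorem *)

Ltac ring_R :=
  match goal with |- @eq _ ?x ?y => change (@eq R x y) end; simpl; ring.

Lemma pochhammer_pos (x : R) (n : nat) : 0 < x -> 0 < pochhammer x n.
Proof.
  intros Hx. induction n as [|n IH]; simpl; [lra|].
  apply Rmult_lt_0_compat; [exact IH|]. assert (H := pos_INR n). lra.
Qed.

Lemma pochhammer_succ_base (c : R) (n : nat) :
  pochhammer (c + 1) n * c = pochhammer c n * (c + INR n).
Proof.
  induction n as [|n IH]; [simpl; ring|].
  change (pochhammer (c + 1) (S n)) with (pochhammer (c + 1) n * (c + 1 + INR n)).
  change (pochhammer c (S n)) with (pochhammer c n * (c + INR n)).
  rewrite S_INR.
  transitivity (pochhammer (c + 1) n * c * (c + 1 + INR n)); [ring|].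
  rewrite IH. ring.
Qed.

(** These are the coefficients inside [hypergeom]; their plain [Series] represents the value at the
    endpoint 1. *)
Definition hyp_coef (a b c : R) (n : nat) : R :=
  pochhammer a n * pochhammer b n / (pochhammer c n * INR (fact n)).

Lemma hyp_coef_S (a b c : R) (n : nat) : 0 < c ->
  (INR n + 1) * hyp_coef a b c (S n)
  = hyp_coef a b c n * ((a + INR n) * (b + INR n) / (c + INR n)).
Proof.
  intros Hc. unfold hyp_coef. rewrite fact_simpl, mult_INR, S_INR. simpl.
  assert (P := pochhammer_pos c n Hc). assert (H := pos_INR n).
  assert (F := INR_fact_lt_0 n). field. repeat split; lra.
Qed.

Lemma hyp_coef_succ_base (a b c : R) (n : nat) : 0 < c ->
  hyp_coef a b (c + 1) n = hyp_coef a b c n * (c / (c + INR n)).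
Proof.
  intros Hc. unfold hyp_coef. assert (P := pochhammer_pos c n Hc).
  assert (H := pos_INR n). assert (F := INR_fact_lt_0 n).
  replace (pochhammer (c + 1) n) with (pochhammer c n * (c + INR n) / c).
  2:{ rewrite <- pochhammer_succ_base. field. lra. }
  field. repeat split; lra.
Qed.

Lemma ex_series_pos_bounded (u : nat -> R) (B : R) :
  (forall n, 0 <= u n) -> (forall n, sum_n u n <= B) -> ex_series u.
Proof.
  intros Hu HB. destruct (ex_finite_lim_seq_incr (sum_n u) B) as [l Hl].
  - intros n. rewrite sum_Sn. unfold plus; simpl. specialize (Hu (S n)). lra.
  - exact HB.
  - exists l. exact Hl.
Qed.

(* Raabe's argument: with [d = c - a - b], [n |v_n|] eventually decreases by at
   least [(d / 2) |v_n|] at each step. *)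
Lemma hyp_coef_raabe (a b c : R) : 0 < c -> 0 < c - a - b ->
  exists N, (1 <= N)%nat /\ forall n, (N <= n)%nat ->
    Rabs (hyp_coef a b c n) <= 2 / (c - a - b) *
      (INR n * Rabs (hyp_coef a b c n) - INR (S n) * Rabs (hyp_coef a b c (S n))).
Proof.
  intros Hc Hd. set (d := c - a - b) in *.
  (* Beyond this [N] both [a + n] and [b + n] are nonnegative, so the ratio of successive
     coefficients carries no sign, and [n d >= 2 a b + c d], which is the claimed inequality after
     clearing denominators. *)
  destruct (INR_unbounded (Rabs a + Rabs b + Rabs (2 * a * b / d) + c)) as [N HN].
  exists (S N). split; [lia|]. intros n Hn.
  assert (Hn' : INR N <= INR n) by (apply le_INR; lia).
  assert (A1 := Rabs_pos a). assert (A2 := Rabs_pos b).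
  assert (A3 := Rabs_pos (2 * a * b / d)).
  assert (A4 := Rle_abs (2 * a * b / d)).
  assert (A5 := Rle_abs (- a)). assert (A6 := Rle_abs (- b)).
  rewrite Rabs_Ropp in A5, A6.
  set (v := hyp_coef a b c) in *. set (x := INR n) in *.
  assert (E : INR (S n) * Rabs (v (S n)) = Rabs (v n) * ((a + x) * (b + x) / (c + x))).
  { rewrite S_INR. fold x.
    rewrite <- (Rabs_pos_eq (x + 1)) at 1 by lra.
    rewrite <- Rabs_mult. unfold v, x. rewrite hyp_coef_S by assumption.
    fold x v. rewrite Rabs_mult. f_equal. apply Rabs_pos_eq.
    apply Rmult_le_pos; [|apply Rlt_le, Rinv_0_lt_compat; lra].
    apply Rmult_le_pos; lra. }
  rewrite E.
  replace (2 / d * (x * Rabs (v n) - Rabs (v n) * ((a + x) * (b + x) / (c + x))))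
    with (Rabs (v n) * (2 / d * (x - (a + x) * (b + x) / (c + x)))) by ring.
  rewrite <- (Rmult_1_r (Rabs (v n))) at 1.
  apply Rmult_le_compat_l; [apply Rabs_pos|].
  assert (Hx : 2 * a * b / d + c <= x) by lra.
  assert (Hx2 : 2 * a * b + c * d <= x * d).
  { apply (Rmult_le_compat_r d) in Hx; [|lra].
    replace ((2 * a * b / d + c) * d) with (2 * a * b + c * d) in Hx by (field; lra).
    exact Hx. }
  apply Rmult_le_reg_r with (d * (c + x)); [apply Rmult_lt_0_compat; lra|].
  replace (2 / d * (x - (a + x) * (b + x) / (c + x)) * (d * (c + x)))
    with (2 * (x * (c - a - b) - a * b)) by (field; lra).
  fold d. lra.
Qed.

Lemma hyp_coef_telescope (a b c : R) (N : nat) :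
  (forall n, (N <= n)%nat -> Rabs (hyp_coef a b c n) <= 2 / (c - a - b) *
      (INR n * Rabs (hyp_coef a b c n) - INR (S n) * Rabs (hyp_coef a b c (S n)))) ->
  forall m, sum_n (fun k => Rabs (hyp_coef a b c (N + k))) m <= 2 / (c - a - b) *
     (INR N * Rabs (hyp_coef a b c N)
      - INR (N + S m) * Rabs (hyp_coef a b c (N + S m))).
Proof.
  intros H m. induction m as [|m IH].
  - rewrite sum_O, Nat.add_0_r. replace (N + 1)%nat with (S N) by lia. now apply H.
  - rewrite sum_Sn. unfold plus; simpl plus.
    assert (X := H (N + S m)%nat ltac:(lia)).
    replace (N + S (S m))%nat with (S (N + S m)) by lia. simpl in *. lra.
Qed.

Lemma ex_series_hyp_coef (a b c : R) : 0 < c -> 0 < c - a - b ->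
  ex_series (fun n => Rabs (hyp_coef a b c n)).
Proof.
  intros Hc Hd. destruct (hyp_coef_raabe a b c Hc Hd) as [N [_ HN]].
  apply (ex_series_incr_n _ N).
  apply ex_series_pos_bounded with (2 / (c - a - b) * (INR N * Rabs (hyp_coef a b c N))).
  - intros; apply Rabs_pos.
  - intros m. apply Rle_trans with (1 := hyp_coef_telescope a b c N HN m).
    apply Rmult_le_compat_l; [apply Rlt_le, Rdiv_lt_0_compat; lra|].
    assert (0 <= INR (N + S m) * Rabs (hyp_coef a b c (N + S m)))
      by (apply Rmult_le_pos; [apply pos_INR | apply Rabs_pos]).
    lra.
Qed.

Lemma ln_succ_le (n : nat) : (1 <= n)%nat -> ln (INR (S n)) - ln (INR n) <= / INR n.
Proof.
  intros Hn. assert (0 < INR n) by (apply lt_0_INR; lia).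
  assert (0 < INR (S n)) by (apply lt_0_INR; lia).
  rewrite <- ln_div by assumption.
  assert (X := exp_ineq1_le (ln (INR (S n) / INR n))).
  rewrite exp_ln in X by (apply Rdiv_lt_0_compat; assumption).
  replace (INR (S n) / INR n) with (1 + / INR n) in X at 2
    by (rewrite S_INR; field; lra).
  lra.
Qed.

(** This removes the boundary term of the telescoping sum in [hyp_sum_succ_base]. By Raabe's
    inequality [n |v_n|] is eventually decreasing, so one small value suffices; a positive lower
    bound [e] would give [|v_n| >= e / n] and force a total decrease as large as a harmonic sum,
    measured by [ln]. *)
Lemma hyp_coef_lim (a b c : R) : 0 < c -> 0 < c - a - b ->
  is_lim_seq (fun n => INR n * hyp_coef a b c n) 0.
Proof.
  intros Hc Hd. destruct (hyp_coef_raabe a b c Hc Hd) as [N [HN1 HN]].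
  set (d := c - a - b) in *. set (v := hyp_coef a b c) in *.
  set (s := fun n => INR n * Rabs (v n)).
  assert (Hdec : forall n, (N <= n)%nat -> s (S n) <= s n).
  { intros n Hn. specialize (HN n Hn). assert (X := Rabs_pos (v n)).
    apply Rmult_le_reg_l with (2 / d); [apply Rdiv_lt_0_compat; lra|].
    unfold s. lra. }
  assert (Hs0 : forall n, 0 <= s n)
    by (intros; apply Rmult_le_pos; [apply pos_INR | apply Rabs_pos]).
  (* If [s] stayed above [e], then [2/d s n + e ln n] would be decreasing. *)
  assert (Hsmall : forall e, 0 < e -> exists n, (N <= n)%nat /\ s n < e).
  { intros e He. destruct (Classical_Prop.classic (exists n, (N <= n)%nat /\ s n < e))
      as [Y|Y]; [exact Y|exfalso].
    assert (Y' : forall n, (N <= n)%nat -> e <= s n).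
    { intros n Hn. apply Rnot_lt_le. intros L. apply Y. now exists n. }
    assert (T : forall m, e * ln (INR (N + m)) + 2 / d * s (N + m)%nat
                  <= e * ln (INR N) + 2 / d * s N).
    { induction m as [|m IH]; [rewrite Nat.add_0_r; lra|].
      apply Rle_trans with (2 := IH). rewrite Nat.add_succ_r.
      assert (Hn : (N <= N + m)%nat) by lia. set (n := (N + m)%nat) in *.
      assert (X := HN n Hn). specialize (Y' n Hn).
      assert (L := ln_succ_le n ltac:(lia)).
      assert (Hn0 : 0 < INR n) by (apply lt_0_INR; lia).
      apply (Rmult_le_compat_l e) in L; [|lra].
      assert (e * / INR n <= Rabs (v n)).
      { apply Rmult_le_reg_r with (INR n); [assumption|].
        rewrite Rmult_assoc, Rinv_l by lra. unfold s in Y'. lra. }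
      unfold s. lra. }
    destruct (INR_unbounded (exp (ln (INR N) + (2 / d * s N) / e))) as [m Hm].
    specialize (T m).
    assert (Hm2 : exp (ln (INR N) + (2 / d * s N) / e) < INR (N + m)).
    { apply Rlt_le_trans with (1 := Hm). apply le_INR; lia. }
    apply ln_increasing in Hm2; [|apply exp_pos]. rewrite ln_exp in Hm2.
    apply (Rmult_lt_compat_l e) in Hm2; [|exact He].
    replace (e * (ln (INR N) + 2 / d * s N / e)) with (e * ln (INR N) + 2 / d * s N)
      in Hm2 by (field; lra).
    assert (0 <= 2 / d * s (N + m)%nat).
    { apply Rmult_le_pos; [apply Rlt_le, Rdiv_lt_0_compat; lra | apply Hs0]. }
    lra. }
  apply is_lim_seq_spec. intros eps.
  destruct (Hsmall eps (cond_pos eps)) as [m [Hm1 Hm2]].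
  exists m. intros n Hn. rewrite Rminus_0_r, Rabs_mult, (Rabs_pos_eq (INR n)) by apply pos_INR.
  fold (s n). apply Rle_lt_trans with (2 := Hm2).
  induction Hn as [|n Hn IH]; [lra|].
  apply Rle_trans with (2 := IH). apply Hdec. lia.
Qed.

(** Termwise, the difference of the two sides telescopes: [(c - a)(c - b) w_n - c (c - a - b) v_n]
    is the increment of [c n v_n], a sequence that starts at 0 and tends to 0. *)
Lemma hyp_sum_succ_base (a b c : R) : 0 < c -> 0 < c - a - b ->
  c * (c - a - b) * Series (hyp_coef a b c)
  = (c - a) * (c - b) * Series (hyp_coef a b (c + 1)).
Proof.
  intros Hc Hd.
  set (v := hyp_coef a b c). set (w := hyp_coef a b (c + 1)).
  assert (Hsum : forall m, sum_n (fun n => (c - a) * (c - b) * w n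
       - c * (c - a - b) * v n) m = c * (INR (S m) * v (S m))).
  { assert (Hterm : forall n, (c - a) * (c - b) * w n - c * (c - a - b) * v n
        = c * (INR (S n) * v (S n)) - c * (INR n * v n)).
    { intros n. rewrite S_INR. unfold v, w. rewrite hyp_coef_S by assumption.
      rewrite hyp_coef_succ_base by assumption. assert (H := pos_INR n).
      field. lra. }
    induction m as [|m IH].
    - rewrite sum_O, Hterm. ring_R.
    - rewrite sum_Sn, IH, Hterm. unfold plus; simpl plus. ring_R. }
  assert (H0 : is_series (fun n => (c - a) * (c - b) * w n - c * (c - a - b) * v n) (c * 0)).
  { change (is_lim_seq (sum_n (fun n => (c - a) * (c - b) * w n
      - c * (c - a - b) * v n)) (c * 0)).
    apply (is_lim_seq_ext _ _ _ (fun m => eq_sym (Hsum m))).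
    apply (is_lim_seq_scal_l _ c 0).
    apply (is_lim_seq_incr_1 (fun n => INR n * v n)). now apply hyp_coef_lim. }
  assert (Hv : is_series v (Series v)).
  { apply Series_correct, ex_series_Rabs, ex_series_hyp_coef; assumption. }
  assert (Hw : is_series w (Series w)).
  { apply Series_correct, ex_series_Rabs, ex_series_hyp_coef; lra. }
  assert (H1 : is_series (fun n => (c - a) * (c - b) * w n - c * (c - a - b) * v n)
     ((c - a) * (c - b) * Series w - c * (c - a - b) * Series v)).
  { apply (is_series_minus (K := R_AbsRing) (V := R_NormedModule)
      (fun n => (c - a) * (c - b) * w n) (fun n => c * (c - a - b) * v n)).
    - apply (is_series_scal_l ((c - a) * (c - b)) w _ Hw).
    - apply (is_series_scal_l (c * (c - a - b)) v _ Hv). }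
  apply is_series_unique in H0. apply is_series_unique in H1.
  rewrite H0 in H1. lra.
Qed.

Lemma hyp_sum_iter (a b c : R) (n : nat) :
  0 < c -> 0 < c - a -> 0 < c - b -> 0 < c - a - b ->
  Series (hyp_coef a b c) =
    pochhammer (c - a) n * pochhammer (c - b) n
      / (pochhammer c n * pochhammer (c - a - b) n)
    * Series (hyp_coef a b (c + INR n)).
Proof.
  intros Hc Ha Hb Hd. induction n as [|n IH].
  - simpl. rewrite Rplus_0_r. field.
  - rewrite IH. assert (H := pos_INR n).
    assert (E := hyp_sum_succ_base a b (c + INR n) ltac:(lra) ltac:(lra)).
    rewrite S_INR, <- Rplus_assoc.
    assert (Pc := pochhammer_pos c n Hc). assert (Pd := pochhammer_pos _ n Hd).
    replace (Series (hyp_coef a b (c + INR n))) with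
      ((c + INR n - a) * (c + INR n - b) * Series (hyp_coef a b (c + INR n + 1))
       / ((c + INR n) * (c + INR n - a - b))).
    2:{ rewrite <- E. field. split; lra. }
    simpl. field. repeat split; lra.
Qed.

(** The first factors [c] and [c + N] are traded exactly, the remaining ones only by monotonicity.
    One factor suffices: it gives the coefficients of positive index the weight [c / (c + N)], which
    tends to 0. *)
Lemma pochhammer_shift_ge (c : R) (N j : nat) : 0 < c ->
  (c + INR N) * pochhammer c (S j) <= c * pochhammer (c + INR N) (S j).
Proof.
  intros Hc. assert (HN := pos_INR N). induction j as [|j IH].
  - simpl. lra.
  - change (pochhammer c (S (S j))) with (pochhammer c (S j) * (c + INR (S j))).
    change (pochhammer (c + INR N) (S (S j)))
      with (pochhammer (c + INR N) (S j) * (c + INR N + INR (S j))).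
    assert (P := pochhammer_pos (c + INR N) (S j) ltac:(lra)).
    assert (P' := pochhammer_pos c (S j) Hc).
    assert (Hj := pos_INR (S j)).
    rewrite <- !Rmult_assoc. apply Rmult_le_compat; try lra.
    apply Rmult_le_pos; lra.
Qed.

(** The term of index 0 equals 1 for every third parameter; all others are dominated by
    [c / (c + n)] times the absolutely convergent series at [c]. *)
Lemma hyp_sum_lim (a b c : R) : 0 < c -> 0 < c - a - b ->
  is_lim_seq (fun n => Series (hyp_coef a b (c + INR n))) 1.
Proof.
  intros Hc Hd.
  set (u := fun j => Rabs (hyp_coef a b c (S j))).
  assert (Hu : ex_series u).
  { apply (ex_series_incr_1 (fun n => Rabs (hyp_coef a b c n))).
    now apply ex_series_hyp_coef. }
  assert (Hb : forall n, Rabs (Series (hyp_coef a b (c + INR n)) - 1)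
                 <= c / (c + INR n) * Series u).
  { intros n. assert (H := pos_INR n).
    assert (Hex : ex_series (fun j => Rabs (hyp_coef a b (c + INR n) j)))
      by (apply ex_series_hyp_coef; lra).
    rewrite Series_incr_1 by now apply ex_series_Rabs.
    replace (hyp_coef a b (c + INR n) 0) with 1 by (unfold hyp_coef; simpl; field).
    replace (1 + _ - 1) with (Series (fun k => hyp_coef a b (c + INR n) (S k))) by ring.
    apply Rle_trans with (Series (fun k => Rabs (hyp_coef a b (c + INR n) (S k)))).
    { apply Series_Rabs.
      now apply (ex_series_incr_1 (fun j => Rabs (hyp_coef a b (c + INR n) j))). }
    rewrite <- Series_scal_l. apply Series_le.
    2:{ apply (ex_series_scal_l (c / (c + INR n)) u Hu). }
    intros j. split; [apply Rabs_pos|]. unfold u, hyp_coef, Rdiv.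
    assert (P := pochhammer_pos (c + INR n) (S j) ltac:(lra)).
    assert (P' := pochhammer_pos c (S j) Hc).
    assert (F := INR_fact_lt_0 (S j)).
    set (q := pochhammer a (S j) * pochhammer b (S j)).
    rewrite !Rabs_mult, !Rabs_inv, !Rabs_mult.
    rewrite (Rabs_pos_eq (pochhammer c _)), (Rabs_pos_eq (pochhammer (c + _) _)),
      (Rabs_pos_eq (INR _)) by lra.
    rewrite !Rinv_mult.
    assert (X := pochhammer_shift_ge c n j Hc).
    assert (Y : / pochhammer (c + INR n) (S j) <= c * / (c + INR n) * / pochhammer c (S j)).
    { apply Rmult_le_reg_r with
        (pochhammer (c + INR n) (S j) * ((c + INR n) * pochhammer c (S j))).
      { apply Rmult_lt_0_compat; [|apply Rmult_lt_0_compat]; lra. }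
      replace (/ pochhammer (c + INR n) (S j) * (pochhammer (c + INR n) (S j) *
        ((c + INR n) * pochhammer c (S j)))) with ((c + INR n) * pochhammer c (S j))
        by (field; lra).
      replace (c * / (c + INR n) * / pochhammer c (S j) * (pochhammer (c + INR n) (S j) *
        ((c + INR n) * pochhammer c (S j)))) with (c * pochhammer (c + INR n) (S j))
        by (field; lra).
      exact X. }
    apply (Rmult_le_compat_l (Rabs q * / INR (fact (S j)))) in Y.
    2:{ apply Rmult_le_pos; [apply Rabs_pos | apply Rlt_le, Rinv_0_lt_compat; lra]. }
    lra. }
  apply (is_lim_seq_le_le (fun n => 1 - c / (c + INR n) * Series u) _
           (fun n => 1 + c / (c + INR n) * Series u)).
  { intros n. specialize (Hb n). apply Rabs_le_between in Hb. lra. }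
  all: assert (L : is_lim_seq (fun n => c / (c + INR n) * Series u) (c * 0 * Series u)).
  1, 3: apply (is_lim_seq_scal_r _ (Series u) (c * 0)); unfold Rdiv;
    apply (is_lim_seq_scal_l _ c 0);
    apply (is_lim_seq_inv _ p_infty); [|discriminate];
    apply (is_lim_seq_plus _ _ c p_infty);
    [apply is_lim_seq_const | apply is_lim_seq_INR | reflexivity].
  - replace (Finite 1) with (Finite (1 - c * 0 * Series u)) by (f_equal; ring).
    apply is_lim_seq_minus'; [apply is_lim_seq_const | exact L].
  - replace (Finite 1) with (Finite (1 + c * 0 * Series u)) by (f_equal; ring).
    apply is_lim_seq_plus'; [apply is_lim_seq_const | exact L].
Qed.

(** The contiguous relation is iterated until the third parameter goes to infinity: the remaining
    sum tends to 1 and the accumulated Pochhammer quotient tends to the quotient of Gamma values,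
    while the left side stays constant. *)
Lemma gauss_summation (a b c : R) :
  0 < c -> 0 < c - a -> 0 < c - b -> 0 < c - a - b ->
  Series (hyp_coef a b c)
  = Gamma c * Gamma (c - a - b) / (Gamma (c - a) * Gamma (c - b)).
Proof.
  intros Hc Ha Hb Hd.
  assert (L : is_lim_seq (fun _ => Series (hyp_coef a b c))
     (Gamma c * Gamma (c - a - b) / (Gamma (c - a) * Gamma (c - b)) * 1)).
  { apply (is_lim_seq_ext _ _ _
      (fun n => eq_sym (hyp_sum_iter a b c (S n) Hc Ha Hb Hd))).
    apply is_lim_seq_mult'.
    - now apply pochhammer_product_lim.
    - apply (is_lim_seq_incr_1 (fun n => Series (hyp_coef a b (c + INR n)))).
      now apply hyp_sum_lim. }
  assert (E := is_lim_seq_unique _ _ L). rewrite Lim_seq_const in E.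
  injection E as E. lra.
Qed.

(** Absolute convergence at 1 makes the tails small uniformly in [x m], whatever the signs of the
    coefficients; the initial sum is a polynomial in [x m]. The two tails and the initial sum take a
    third of [eps] each. *)
Lemma PSeries_lim_1 (u : nat -> R) (x : nat -> R) :
  ex_series (fun n => Rabs (u n)) ->
  (forall m, 0 <= x m <= 1) -> is_lim_seq x 1 ->
  is_lim_seq (fun m => PSeries u (x m)) (Series u).
Proof.
  intros Hu Hx Hlim.
  assert (Hb : forall m n, Rabs (u n * x m ^ n) <= Rabs (u n)).
  { intros m n. rewrite Rabs_mult. rewrite <- (Rmult_1_r (Rabs (u n))) at 2.
    apply Rmult_le_compat_l; [apply Rabs_pos|].
    rewrite Rabs_pos_eq by (apply pow_le, Hx).
    rewrite <- (pow1 n). apply pow_incr, Hx. }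
  assert (Hex : forall m, ex_series (fun n => Rabs (u n * x m ^ n))).
  { intros m. apply (ex_series_le (V := R_CompleteNormedModule) _ (fun n => Rabs (u n)));
      [|exact Hu].
    intros n. unfold norm; simpl. unfold abs; simpl. rewrite Rabs_Rabsolu. apply Hb. }
  apply is_lim_seq_spec. intros eps.
  assert (He : 0 < eps / 3) by (assert (Y := cond_pos eps); lra).
  assert (Htail : is_lim_seq (sum_n (fun n => Rabs (u n))) (Series (fun n => Rabs (u n))))
    by exact (Series_correct _ Hu).
  destruct (proj2 (is_lim_seq_spec _ _) Htail (mkposreal _ He)) as [N HN].
  specialize (HN N (le_n N)). simpl in HN.
  set (T := Series (fun n => Rabs (u (S N + n)%nat))).
  assert (HT : T < eps / 3).
  { assert (E := Series_incr_n (fun n => Rabs (u n)) (S N) ltac:(lia) Hu).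
    simpl pred in E. rewrite <- sum_n_Reals in E. fold T in E.
    apply Rabs_def2 in HN. lra. }
  assert (Hfin : is_lim_seq (fun m => sum_n (fun n => u n * x m ^ n) N) (sum_n u N)).
  { clear - Hlim. induction N as [|N IH].
    - apply is_lim_seq_ext with (fun _ => u O).
      + intros m. rewrite sum_O. simpl. ring.
      + rewrite sum_O. apply is_lim_seq_const.
    - apply is_lim_seq_ext with
        (fun m => sum_n (fun n => u n * x m ^ n) N + u (S N) * x m ^ S N).
      + intros m. rewrite sum_Sn. reflexivity.
      + rewrite sum_Sn. apply is_lim_seq_plus'; [exact IH|].
        replace (Finite (u (S N))) with (Finite (u (S N) * 1 ^ S N))
          by (rewrite pow1, Rmult_1_r; reflexivity).
        apply (is_lim_seq_scal_l _ (u (S N)) (1 ^ S N)).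
        apply (is_lim_seq_continuous (fun y => y ^ S N)); [|exact Hlim].
        apply derivable_continuous_pt, derivable_pt_pow. }
  destruct (proj2 (is_lim_seq_spec _ _) Hfin (mkposreal _ He)) as [m0 Hm0].
  exists m0. intros m Hm. specialize (Hm0 m Hm). simpl in Hm0.
  unfold PSeries.
  rewrite (Series_incr_n u (S N)) by (try lia; now apply ex_series_Rabs).
  rewrite (Series_incr_n (fun k => u k * x m ^ k) (S N))
    by (try lia; apply ex_series_Rabs, Hex).
  simpl pred. rewrite <- !sum_n_Reals.
  assert (HuT : ex_series (fun n => Rabs (u (S N + n)%nat)))
    by (now apply (ex_series_incr_n (fun n => Rabs (u n)) (S N))).
  assert (B1 : Rabs (Series (fun k => u (S N + k)%nat)) <= T)
    by (now apply Series_Rabs).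
  assert (B2 : Rabs (Series (fun k => u (S N + k)%nat * x m ^ (S N + k))) <= T).
  { apply Rle_trans with (Series (fun k => Rabs (u (S N + k)%nat * x m ^ (S N + k)))).
    - apply Series_Rabs.
      now apply (ex_series_incr_n (fun n => Rabs (u n * x m ^ n)) (S N)).
    - apply Series_le; [|exact HuT]. intros k. split; [apply Rabs_pos | apply Hb]. }
  apply Rabs_le_between in B1. apply Rabs_le_between in B2.
  apply Rabs_def2 in Hm0. apply Rabs_def1; lra.
Qed.

(** * Pairs of Fourier coefficients *)

Lemma is_RInt_Rplus (g h : R -> R) (a b lg lh : R) :
  is_RInt g a b lg -> is_RInt h a b lh -> is_RInt (fun t => g t + h t) a b (lg + lh).
Proof. exact (is_RInt_plus (V := R_NormedModule) g h a b lg lh). Qed.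

Lemma is_RInt_Rscal (g : R -> R) (a b w l : R) :
  is_RInt g a b l -> is_RInt (fun t => w * g t) a b (w * l).
Proof. exact (is_RInt_scal (V := R_NormedModule) g a b w l). Qed.

Lemma abs_cos_add_INR_PI (u : R) (m : nat) : Rabs (cos (u + INR m * PI)) = Rabs (cos u).
Proof.
  induction m as [|m IH]; [f_equal; f_equal; simpl; ring|].
  rewrite S_INR. replace (u + (INR m + 1) * PI) with (u + INR m * PI + PI) by ring.
  rewrite neg_cos, Rabs_Ropp. exact IH.
Qed.

(** Starting at [- PI / 2] puts the zeros of the cosine at the ends of the pieces, so the sign is
    constant on each piece of length [PI], and each contributes 2. *)
Lemma is_RInt_abs_cos (m : nat) :
  is_RInt (fun u => Rabs (cos u)) (- (PI / 2)) (INR m * PI - PI / 2) (2 * INR m).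
Proof.
  assert (HPI := PI_RGT_0).
  induction m as [|m IH].
  - simpl INR. rewrite Rmult_0_l, Rmult_0_r, Rminus_0_l.
    apply (is_RInt_point (V := R_NormedModule)).
  - rewrite S_INR. replace (2 * (INR m + 1)) with (plus (2 * INR m) 2)
      by (unfold plus; simpl; ring).
    apply (is_RInt_Chasles (V := R_NormedModule)) with (1 := IH).
    apply (is_RInt_ext (V := R_NormedModule) (fun u => cos (u - INR m * PI))).
    + rewrite Rmin_left, Rmax_right by lra. intros u Hu.
      replace (cos u) with (cos (u - INR m * PI + INR m * PI)) by (f_equal; ring).
      rewrite abs_cos_add_INR_PI. symmetry. apply Rabs_pos_eq.
      apply cos_ge_0; lra.
    + assert (H : is_RInt (fun u => cos (u - INR m * PI))
          (INR m * PI - PI / 2) ((INR m + 1) * PI - PI / 2)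
          (minus (sin ((INR m + 1) * PI - PI / 2 - INR m * PI))
                 (sin (INR m * PI - PI / 2 - INR m * PI)))).
      { apply (is_RInt_derive (V := R_CompleteNormedModule)
          (fun u => sin (u - INR m * PI))); intros u _.
        - auto_derive; auto. apply Rmult_1_l.
        - apply (ex_derive_continuous (K := R_AbsRing) (V := R_NormedModule)).
          auto_derive; auto. }
      replace ((INR m + 1) * PI - PI / 2 - INR m * PI) with (PI / 2) in H by field.
      replace (INR m * PI - PI / 2 - INR m * PI) with (- (PI / 2)) in H by ring.
      rewrite sin_neg, sin_PI2 in H. unfold minus, plus, opp in H; simpl in H.
      replace (1 + - - (1)) with 2 in H by ring. exact H.
Qed.

(** The starting point solves [k a + phi = - PI / 2]; the period then maps onto exactly [2 k] arches
    of the cosine, and no invariance under shifts of the period is required. *)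
Lemma is_RInt_abs_cos_affine (k : nat) (phi : R) : (1 <= k)%nat ->
  let a := (- (PI / 2) - phi) / INR k in
  is_RInt (fun t => Rabs (cos (INR k * t + phi))) a (a + 2 * PI) 4.
Proof.
  intros Hk a. assert (HK : 0 < INR k) by (apply lt_0_INR; lia).
  assert (H : is_RInt (fun u => Rabs (cos u)) (INR k * a + phi)
                (INR k * (a + 2 * PI) + phi) (INR k * 4)).
  { assert (X := is_RInt_abs_cos (2 * k)). rewrite mult_INR in X. simpl (INR 2) in X.
    replace (INR k * a + phi) with (- (PI / 2)) by (unfold a; field; lra).
    replace (INR k * (a + 2 * PI) + phi) with (2 * INR k * PI - PI / 2)
      by (unfold a; field; lra).
    replace (INR k * 4) with (2 * (2 * INR k)) by ring. exact X. }
  apply (is_RInt_comp_lin (V := R_NormedModule)) in H.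
  apply (is_RInt_scal (V := R_NormedModule) _ _ _ (/ INR k)) in H.
  replace 4 with (scal (/ INR k) (INR k * 4)) by
    (unfold scal; simpl; unfold mult; simpl; field; lra).
  apply (is_RInt_ext (V := R_NormedModule)) with (2 := H).
  intros t _. unfold scal; simpl; unfold mult; simpl. field. lra.
Qed.

(** Writing the frequency as a difference of naturals serves both [j + k] and the possibly negative
    [j - k] of the product formulas. *)
Lemma is_RInt_cos_period (p q : nat) (a psi : R) :
  is_RInt (fun t => cos ((INR p - INR q) * t + psi)) a (a + 2 * PI)
    ((if Nat.eq_dec p q then 2 * PI * cos psi else 0) : R).
Proof.
  destruct (Nat.eq_dec p q) as [E|E].
  - apply (is_RInt_ext (V := R_NormedModule) (fun _ => cos psi)).
    + intros t _. f_equal. rewrite E. ring.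
    + replace (2 * PI * cos psi) with (scal (a + 2 * PI - a) (cos psi))
        by (unfold scal; simpl; unfold mult; simpl; ring).
      apply (is_RInt_const (V := R_NormedModule)).
  - assert (D : INR p - INR q <> 0).
    { intros D. apply E, INR_eq. lra. }
    set (d := INR p - INR q) in *.
    assert (P : sin (d * (a + 2 * PI) + psi) = sin (d * a + psi)).
    { rewrite <- (sin_period (d * a + psi) p).
      rewrite <- (sin_period (d * (a + 2 * PI) + psi) q).
      f_equal. unfold d. ring. }
    replace 0 with (minus (sin (d * (a + 2 * PI) + psi) / d) (sin (d * a + psi) / d))
      by (rewrite P; apply (minus_eq_zero (G := R_AbelianGroup))).
    apply (is_RInt_derive (V := R_CompleteNormedModule)
             (fun t => sin (d * t + psi) / d)); intros u _.
    + auto_derive; auto. field. exact D.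
    + apply (ex_derive_continuous (K := R_AbsRing) (V := R_NormedModule)).
      auto_derive; auto.
Qed.

Definition trig_term (x y : nat -> R) (t : R) (j : nat) : R :=
  x j * cos (INR j * t) + y j * sin (INR j * t).

(** Product-to-sum formulas, with sines written as cosines shifted by [PI / 2] so that one integral
    covers all four terms. The frequency [j + k] never vanishes because [k >= 1]; only [j - k] can
    contribute. *)
Lemma is_RInt_trig_term (x y : nat -> R) (a phi : R) (j k : nat) : (1 <= k)%nat ->
  is_RInt (fun t => trig_term x y t j * cos (INR k * t + phi)) a (a + 2 * PI)
    ((if Nat.eq_dec j k then PI * (x k * cos phi - y k * sin phi) else 0) : R).
Proof.
  intros Hk.
  assert (H : is_RInt (fun t =>
       (x j / 2 * cos ((INR (j + k) - INR 0) * t + phi)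
        + x j / 2 * cos ((INR j - INR k) * t + - phi))
     + (y j / 2 * cos ((INR (j + k) - INR 0) * t + (phi - PI / 2))
        + y j / 2 * cos ((INR j - INR k) * t + (- phi - PI / 2)))) a (a + 2 * PI)
     ((x j / 2 * 0 + x j / 2 * (if Nat.eq_dec j k then 2 * PI * cos (- phi) else 0))
      + (y j / 2 * 0
         + y j / 2 * (if Nat.eq_dec j k then 2 * PI * cos (- phi - PI / 2) else 0)))).
  { assert (Z : forall psi,
      is_RInt (fun t => cos ((INR (j + k) - INR 0) * t + psi)) a (a + 2 * PI) 0).
    { intros psi. assert (X := is_RInt_cos_period (j + k) 0 a psi).
      destruct (Nat.eq_dec (j + k) 0); [lia|exact X]. }
    exact (is_RInt_Rplus _ _ _ _ _ _
      (is_RInt_Rplus _ _ _ _ _ _ (is_RInt_Rscal _ _ _ _ _ (Z _))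
        (is_RInt_Rscal _ _ _ _ _ (is_RInt_cos_period j k a _)))
      (is_RInt_Rplus _ _ _ _ _ _ (is_RInt_Rscal _ _ _ _ _ (Z _))
        (is_RInt_Rscal _ _ _ _ _ (is_RInt_cos_period j k a _)))). }
  assert (E : (x j / 2 * 0
        + x j / 2 * (if Nat.eq_dec j k then 2 * PI * cos (- phi) else 0))
      + (y j / 2 * 0
         + y j / 2 * (if Nat.eq_dec j k then 2 * PI * cos (- phi - PI / 2) else 0))
      = if Nat.eq_dec j k then PI * (x k * cos phi - y k * sin phi) else 0).
  { destruct (Nat.eq_dec j k) as [->|]; [|ring].
    replace (- phi - PI / 2) with (- (PI / 2 + phi)) by ring.
    rewrite !cos_neg, cos_plus, cos_PI2, sin_PI2. field. }
  rewrite E in H.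
  apply (is_RInt_ext (V := R_NormedModule)) with (2 := H).
  intros t _. unfold trig_term. rewrite plus_INR. simpl (INR 0).
  replace ((INR j + INR k - 0) * t + phi) with (INR j * t + (INR k * t + phi)) by ring.
  replace ((INR j - INR k) * t + - phi) with (INR j * t - (INR k * t + phi)) by ring.
  replace ((INR j + INR k - 0) * t + (phi - PI / 2))
    with (INR j * t + (INR k * t + phi) - PI / 2) by ring.
  replace ((INR j - INR k) * t + (- phi - PI / 2))
    with (INR j * t - (INR k * t + phi) - PI / 2) by ring.
  set (w := INR k * t + phi). set (v := INR j * t).
  rewrite (cos_minus (_ + _) (PI / 2)), (cos_minus (_ - _) (PI / 2)), cos_PI2, sin_PI2.
  rewrite cos_plus, cos_minus, sin_plus, sin_minus.
  match goal with |- @eq _ ?u ?v => change (@eq R u v) end. field.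
Qed.

Lemma is_RInt_trig_sum (x y : nat -> R) (a phi : R) (k n : nat) :
  (1 <= k <= n)%nat ->
  is_RInt (fun t => sum_n (trig_term x y t) n * cos (INR k * t + phi)) a (a + 2 * PI)
    (PI * (x k * cos phi - y k * sin phi)).
Proof.
  intros Hk.
  assert (H : forall m, is_RInt (fun t => sum_n (trig_term x y t) m * cos (INR k * t + phi))
     a (a + 2 * PI)
     ((if le_dec k m then PI * (x k * cos phi - y k * sin phi) else 0) : R)).
  { induction m as [|m IH].
    - assert (X := is_RInt_trig_term x y a phi 0 k ltac:(lia)).
      destruct (Nat.eq_dec 0 k); [lia|]. destruct (le_dec k 0); [lia|].
      apply (is_RInt_ext (V := R_NormedModule)) with (2 := X).
      intros t _. rewrite sum_O. reflexivity.
    - assert (X := is_RInt_Rplus _ _ _ _ _ _ IH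
        (is_RInt_trig_term x y a phi (S m) k ltac:(lia))).
      assert (E : (if le_dec k m then PI * (x k * cos phi - y k * sin phi) else 0)
          + (if Nat.eq_dec (S m) k then PI * (x k * cos phi - y k * sin phi) else 0)
        = if le_dec k (S m) then PI * (x k * cos phi - y k * sin phi) else 0).
      { destruct (le_dec k m), (Nat.eq_dec (S m) k), (le_dec k (S m)); try lia; ring. }
      rewrite E in X.
      apply (is_RInt_ext (V := R_NormedModule)) with (2 := X).
      intros t _. rewrite sum_Sn. unfold plus; simpl. ring_R. }
  specialize (H n). destruct (le_dec k n); [exact H|lia].
Qed.

(** The sup bound is integrated against [|cos (k t + phi)|] instead of 1, which costs [4 K] rather
    than [2 PI K]. *)
Lemma trig_sum_coef_le (x y : nat -> R) (K phi : R) (k n : nat) :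
  (1 <= k <= n)%nat -> (forall t, Rabs (sum_n (trig_term x y t) n) <= K) ->
  x k * cos phi - y k * sin phi <= 4 * K / PI.
Proof.
  intros Hk HK. assert (HPI := PI_RGT_0).
  set (a := (- (PI / 2) - phi) / INR k).
  assert (H1 := is_RInt_trig_sum x y a phi k n Hk).
  assert (H2 := is_RInt_scal (V := R_NormedModule) _ _ _ K _
    (is_RInt_abs_cos_affine k phi ltac:(lia))).
  fold a in H2.
  apply Rmult_le_reg_l with PI; [exact HPI|].
  replace (PI * (4 * K / PI)) with (scal K 4)
    by (unfold scal; simpl; unfold mult; simpl; field; lra).
  refine (is_RInt_le _ _ _ _ _ _ _ H1 H2 _); [lra|].
  intros t _. unfold scal; simpl; unfold mult; simpl.
  apply Rle_trans with (1 := Rle_abs _). rewrite Rabs_mult.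
  apply Rmult_le_compat_r; [apply Rabs_pos | apply HK].
Qed.

(** Sum and integral are never interchanged: the finite estimate is applied to a partial sum,
    bounded by [M] plus a uniform tail. A tail below [eps * PI / 4] turns into an error of [eps]. *)
Lemma trig_series_coef_le (x y : nat -> R) (M phi : R) (k : nat) :
  (1 <= k)%nat -> ex_series (fun j => Rabs (x j) + Rabs (y j)) ->
  (forall t, Rabs (Series (trig_term x y t)) <= M) ->
  x k * cos phi - y k * sin phi <= 4 * M / PI.
Proof.
  intros Hk Hxy HM. assert (HPI := PI_RGT_0).
  set (b := fun j => Rabs (x j) + Rabs (y j)) in *.
  assert (Hb : forall t j, Rabs (trig_term x y t j) <= b j).
  { intros t j. unfold trig_term, b. apply Rle_trans with (1 := Rabs_triang _ _).
    rewrite !Rabs_mult.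
    assert (C1 : Rabs (cos (INR j * t)) <= 1) by (apply Rabs_le, COS_bound).
    assert (C2 : Rabs (sin (INR j * t)) <= 1) by (apply Rabs_le, SIN_bound).
    assert (X := Rabs_pos (x j)). assert (Y := Rabs_pos (y j)).
    apply Rplus_le_compat; rewrite <- Rmult_1_r; apply Rmult_le_compat_l; assumption. }
  assert (Hex : forall t, ex_series (fun j => Rabs (trig_term x y t j))).
  { intros t. apply (ex_series_le (V := R_CompleteNormedModule) _ b); [|exact Hxy].
    intros j. unfold norm; simpl; unfold abs; simpl. rewrite Rabs_Rabsolu. apply Hb. }
  apply le_epsilon. intros eps Heps.
  assert (He : 0 < eps * PI / 4) by nra.
  assert (Hs : is_lim_seq (sum_n b) (Series b)) by exact (Series_correct _ Hxy).
  destruct (proj2 (is_lim_seq_spec _ _) Hs (mkposreal _ He)) as [N HN].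
  set (n := Nat.max N k). specialize (HN n ltac:(lia)). simpl in HN.
  replace (4 * M / PI + eps) with (4 * (M + eps * PI / 4) / PI) by (field; lra).
  apply trig_sum_coef_le with n; [lia|]. intros t.
  specialize (HM t).
  rewrite (Series_incr_n _ (S n)) in HM by (try lia; apply ex_series_Rabs, Hex).
  rewrite (Series_incr_n b (S n)) in HN by (try lia; exact Hxy).
  simpl pred in *. rewrite <- sum_n_Reals in HM, HN.
  assert (T : Rabs (Series (fun j => trig_term x y t (S n + j)))
          <= Series (fun j => b (S n + j)%nat)).
  { eapply Rle_trans.
    - apply Series_Rabs.
      apply (ex_series_incr_n (fun j => Rabs (trig_term x y t j)) (S n)), Hex.
    - apply Series_le; [|now apply (ex_series_incr_n b (S n))].
      intros j. split; [apply Rabs_pos | apply Hb]. }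
  apply Rabs_le_between in T. apply Rabs_le_between in HM.
  apply Rabs_def2 in HN. apply Rabs_le. lra.
Qed.

(** * Polar form, componentwise convergence and the estimate for complex coefficients *)

Lemma Cmod_Cexp_i (t : R) : Cmod (Cexp_i t) = 1.
Proof.
  unfold Cmod, Cexp_i; simpl fst; simpl snd.
  replace (cos t ^ 2 + sin t ^ 2) with 1
    by (assert (X := sin2_cos2 t); unfold Rsqr in X; lra).
  apply sqrt_1.
Qed.

Lemma polar_form (z : C) : exists a, z = (RtoC (Cmod z) * Cexp_i a)%C.
Proof.
  destruct (Req_dec (Cmod z) 0) as [Z|Z].
  - exists 0. rewrite (Cmod_eq_0 _ Z), Cmod_0. ring.
  - assert (P : 0 < Cmod z) by (assert (X := Cmod_ge_0 z); lra).
    destruct z as [u v]. set (r := Cmod (u, v)) in *.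
    assert (E : u * u + v * v = r * r).
    { unfold r, Cmod. simpl fst. simpl snd. rewrite sqrt_sqrt; [ring|].
      apply Rplus_le_le_0_compat; apply pow2_ge_0. }
    assert (B : -1 <= u / r <= 1).
    { assert (u / r * (u / r) <= 1); [|split; nra].
      apply Rmult_le_reg_r with (r * r); [nra|].
      replace (u / r * (u / r) * (r * r)) with (u * u) by (field; lra). nra. }
    assert (S : sin (acos (u / r)) = Rabs v / r).
    { rewrite sin_acos by exact B. rewrite <- (Rabs_pos_eq r) at 2 by lra.
      rewrite <- Rabs_div by lra. rewrite <- sqrt_Rsqr_abs. f_equal.
      unfold Rsqr. apply Rmult_eq_reg_r with (r * r); [|nra].
      transitivity (r * r - u * u); [field; lra|].
      transitivity (v * v); [lra|]. field. lra. }
    destruct (Rle_lt_dec 0 v) as [V|V].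
    + exists (acos (u / r)). unfold Cexp_i. rewrite cos_acos, S, Rabs_pos_eq by assumption.
      unfold Cmult, RtoC; simpl. f_equal; field; lra.
    + exists (- acos (u / r)). unfold Cexp_i.
      rewrite cos_neg, sin_neg, cos_acos, S, Rabs_left by assumption.
      unfold Cmult, RtoC; simpl. f_equal; field; lra.
Qed.

Lemma sum_n_C (a : nat -> C) (n : nat) :
  sum_n (G := C_AbelianGroup) a n = (sum_n (fun j => Re (a j)) n, sum_n (fun j => Im (a j)) n).
Proof.
  induction n as [|n IH].
  - rewrite !sum_O. destruct (a O); reflexivity.
  - rewrite !sum_Sn, IH. reflexivity.
Qed.

Lemma is_series_C (a : nat -> C) (l : C) :
  is_series (K := C_AbsRing) (V := C_NormedModule) a l ->
  is_series (fun n => Re (a n)) (Re l) /\ is_series (fun n => Im (a n)) (Im l).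
Proof.
  intros H. unfold is_series in H.
  split.
  - change (is_lim_seq (sum_n (fun n => Re (a n))) (Re l)).
    apply (is_lim_seq_ext (fun n => Re (sum_n (G := C_AbelianGroup) a n))).
    { intros n. rewrite sum_n_C. reflexivity. }
    eapply filterlim_comp; [exact H|]. intros P [eps HP]. exists eps.
    intros z Hz. apply HP. apply Hz.
  - change (is_lim_seq (sum_n (fun n => Im (a n))) (Im l)).
    apply (is_lim_seq_ext (fun n => Im (sum_n (G := C_AbelianGroup) a n))).
    { intros n. rewrite sum_n_C. reflexivity. }
    eapply filterlim_comp; [exact H|]. intros P [eps HP]. exists eps.
    intros z Hz. apply HP. apply Hz.
Qed.

(* Writing [A k = |A k| e^(i (s + p))] and [B k = |B k| e^(i (s - p))], the real part
   of [e^(-i s)] times the series has [k]-th harmonic [(|A k| + |B k|) cos (k t + p)]. *)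
Lemma fourier_pair_le (A B : nat -> C) (M : R) (k : nat) :
  (1 <= k)%nat -> ex_series (fun j => Cmod (A j) + Cmod (B j)) ->
  (forall t, exists S1 S2,
     is_series (K := C_AbsRing) (V := C_NormedModule)
       (fun j => A j * Cexp_i (INR j * t))%C S1 /\
     is_series (K := C_AbsRing) (V := C_NormedModule)
       (fun j => B j * Cexp_i (- (INR j * t)))%C S2 /\
     Cmod (S1 + S2) <= M) ->
  Cmod (A k) + Cmod (B k) <= 4 * M / PI.
Proof.
  intros Hk Hsum Hser.
  destruct (polar_form (A k)) as [a Ha]. destruct (polar_form (B k)) as [b Hb].
  set (s := (a + b) / 2). set (p := (a - b) / 2).
  (* [x j] and [y j] are the cosine and sine coefficients of the real part of [e^(-i s) (A_j e^(i j
     t) + B_j e^(-i j t))]. *)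
  set (x := fun j => Re (A j * Cexp_i (- s))%C + Re (B j * Cexp_i (- s))%C).
  set (y := fun j => Im (B j * Cexp_i (- s))%C - Im (A j * Cexp_i (- s))%C).
  replace (Cmod (A k) + Cmod (B k)) with (x k * cos p - y k * sin p).
  2:{ unfold x, y. rewrite Ha at 1 2. rewrite Hb at 1 2.
      replace (RtoC (Cmod (A k)) * Cexp_i a * Cexp_i (- s))%C
        with (RtoC (Cmod (A k)) * Cexp_i p)%C.
      2:{ replace p with (a + - s) by (unfold p, s; field).
          unfold Cexp_i. rewrite cos_plus, sin_plus.
          unfold Cmult, RtoC; simpl. f_equal; ring. }
      replace (RtoC (Cmod (B k)) * Cexp_i b * Cexp_i (- s))%C
        with (RtoC (Cmod (B k)) * Cexp_i (- p))%C.
      2:{ replace (- p) with (b + - s) by (unfold p, s; field).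
          unfold Cexp_i. rewrite cos_plus, sin_plus.
          unfold Cmult, RtoC; simpl. f_equal; ring. }
      unfold Cexp_i, Cmult, RtoC, Re, Im; simpl. rewrite cos_neg, sin_neg.
      assert (X := sin2_cos2 p). unfold Rsqr in X.
      transitivity ((Cmod (A k) + Cmod (B k)) * (sin p * sin p + cos p * cos p)); [ring|].
      rewrite X. ring. }
  apply trig_series_coef_le; [exact Hk| |].
  - apply (ex_series_le (V := R_CompleteNormedModule) _
      (fun j => 2 * (Cmod (A j) + Cmod (B j)))).
    2:{ apply (ex_series_scal_l 2 _ Hsum). }
    intros j. unfold norm; simpl; unfold abs; simpl.
    rewrite Rabs_pos_eq by (apply Rplus_le_le_0_compat; apply Rabs_pos).
    assert (Q : forall z : C, Rabs (Re (z * Cexp_i (- s))%C) <= Cmod z /\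
                        Rabs (Im (z * Cexp_i (- s))%C) <= Cmod z).
    { intros z. assert (E : Cmod (z * Cexp_i (- s)) = Cmod z)
        by (rewrite Cmod_mult, Cmod_Cexp_i; ring).
      rewrite <- E. assert (X := Rmax_Cmod (z * Cexp_i (- s))%C).
      split; apply Rle_trans with (2 := X); [apply Rmax_l | apply Rmax_r]. }
    unfold x, y. destruct (Q (A j)), (Q (B j)).
    assert (T1 := Rabs_triang (Re (A j * Cexp_i (- s))%C) (Re (B j * Cexp_i (- s))%C)).
    assert (T2 := Rabs_triang (Im (B j * Cexp_i (- s))%C) (- Im (A j * Cexp_i (- s))%C)).
    rewrite Rabs_Ropp in T2. unfold Rminus. lra.
  - intros t. destruct (Hser t) as (S1 & S2 & H1 & H2 & H3).
    apply is_series_C in H1. apply is_series_C in H2.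
    destruct H1 as [R1 I1], H2 as [R2 I2].
    assert (L : is_series (trig_term x y t)
       (cos s * (Re S1 + Re S2) + sin s * (Im S1 + Im S2))).
    { refine (is_series_ext _ _ _ _
        (is_series_plus (K := R_AbsRing) (V := R_NormedModule) _ _ _ _
        (is_series_scal_l (cos s) _ _
          (is_series_plus (K := R_AbsRing) (V := R_NormedModule) _ _ _ _ R1 R2))
        (is_series_scal_l (sin s) _ _
          (is_series_plus (K := R_AbsRing) (V := R_NormedModule) _ _ _ _ I1 I2)))).
      intros j. unfold trig_term, x, y, Cexp_i, Cmult, Re, Im, plus; simpl.
      rewrite !cos_neg, !sin_neg. unfold scal; simpl; unfold mult; ring_R. }
    rewrite (is_series_unique _ _ L).
    replace (cos s * (Re S1 + Re S2) + sin s * (Im S1 + Im S2))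
      with (Re ((S1 + S2) * Cexp_i (- s))%C).
    2:{ unfold Cexp_i, Cmult, Cplus, Re, Im; simpl. rewrite cos_neg, sin_neg. ring. }
    apply Rle_trans with (2 := H3).
    replace (Cmod (S1 + S2)) with (Cmod ((S1 + S2) * Cexp_i (- s)))
      by (rewrite Cmod_mult, Cmod_Cexp_i; ring).
    apply Rle_trans with (2 := Rmax_Cmod _). apply Rmax_l.
Qed.

(** * Convergence of the expansion and the limit at the boundary *)

Lemma Rabs_pochhammer_le (a : R) (n : nat) :
  Rabs (pochhammer a n) <= pochhammer (1 + Rabs a) n.
Proof.
  induction n as [|n IH]; simpl; [rewrite Rabs_R1; lra|].
  rewrite Rabs_mult. assert (H := pos_INR n). assert (A := Rabs_pos a).
  apply Rmult_le_compat; try apply Rabs_pos; [exact IH|].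
  apply Rle_trans with (1 := Rabs_triang _ _). rewrite (Rabs_pos_eq (INR n)); lra.
Qed.

(** Factor by factor, [|k + b + i| / (k + 1 + i)] is at most [(1 + |b| + i) / (1 + i)], so the
    growth of the numerator with [k] is absorbed by the third parameter [k + 1]. *)
Lemma pochhammer_quotient_le (b : R) (k n : nat) :
  Rabs (pochhammer (INR k + b) n) / pochhammer (INR k + 1) n
  <= pochhammer (1 + Rabs b) n / pochhammer 1 n.
Proof.
  assert (A := Rabs_pos b). assert (Hk := pos_INR k).
  induction n as [|n IH]; simpl; [rewrite Rabs_R1; lra|].
  rewrite Rabs_mult. assert (H := pos_INR n).
  assert (P := pochhammer_pos (INR k + 1) n ltac:(lra)).
  assert (P1 := pochhammer_pos 1 n ltac:(lra)).
  replace (Rabs (pochhammer (INR k + b) n) * Rabs (INR k + b + INR n) /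
     (pochhammer (INR k + 1) n * (INR k + 1 + INR n)))
    with (Rabs (pochhammer (INR k + b) n) / pochhammer (INR k + 1) n
          * (Rabs (INR k + b + INR n) / (INR k + 1 + INR n))) by (field; lra).
  replace (pochhammer (1 + Rabs b) n * (1 + Rabs b + INR n) /
     (pochhammer 1 n * (1 + INR n)))
    with (pochhammer (1 + Rabs b) n / pochhammer 1 n
          * ((1 + Rabs b + INR n) / (1 + INR n))) by (field; lra).
  apply Rmult_le_compat.
  - apply Rmult_le_pos; [apply Rabs_pos | apply Rlt_le, Rinv_0_lt_compat; lra].
  - apply Rmult_le_pos; [apply Rabs_pos | apply Rlt_le, Rinv_0_lt_compat; lra].
  - exact IH.
  - assert (B : Rabs (INR k + b + INR n) <= INR k + Rabs b + INR n).
    { apply Rabs_le_between. assert (X := Rle_abs b). assert (Y := Rle_abs (- b)).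
      rewrite Rabs_Ropp in Y. lra. }
    apply Rmult_le_reg_r with ((INR k + 1 + INR n) * (1 + INR n)).
    { apply Rmult_lt_0_compat; lra. }
    replace (Rabs (INR k + b + INR n) / (INR k + 1 + INR n) *
        ((INR k + 1 + INR n) * (1 + INR n)))
      with (Rabs (INR k + b + INR n) * (1 + INR n)) by (field; lra).
    replace ((1 + Rabs b + INR n) / (1 + INR n) * ((INR k + 1 + INR n) * (1 + INR n)))
      with ((1 + Rabs b + INR n) * (INR k + 1 + INR n)) by (field; lra).
    apply Rle_trans with ((INR k + Rabs b + INR n) * (1 + INR n)); [|nra].
    apply Rmult_le_compat_r; lra.
Qed.

Lemma hyp_coef_dominated (b : R) (k n : nat) :
  Rabs (hyp_coef b (INR k + b) (INR k + 1) n)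
  <= hyp_coef (1 + Rabs b) (1 + Rabs b) 1 n.
Proof.
  assert (Hk := pos_INR k).
  assert (P := pochhammer_pos (INR k + 1) n ltac:(lra)).
  assert (P1 := pochhammer_pos 1 n ltac:(lra)). assert (F := INR_fact_lt_0 n).
  replace (hyp_coef b (INR k + b) (INR k + 1) n)
    with (pochhammer b n * / INR (fact n)
          * (pochhammer (INR k + b) n / pochhammer (INR k + 1) n))
    by (unfold hyp_coef; field; lra).
  replace (hyp_coef (1 + Rabs b) (1 + Rabs b) 1 n)
    with (pochhammer (1 + Rabs b) n * / INR (fact n)
          * (pochhammer (1 + Rabs b) n / pochhammer 1 n))
    by (unfold hyp_coef; field; lra).
  unfold Rdiv. rewrite !Rabs_mult, !Rabs_inv, (Rabs_pos_eq (INR _)),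
    (Rabs_pos_eq (pochhammer (INR k + 1) n)) by lra.
  assert (0 < / INR (fact n)) by now apply Rinv_0_lt_compat.
  assert (0 < / pochhammer (INR k + 1) n) by now apply Rinv_0_lt_compat.
  apply Rmult_le_compat.
  - apply Rmult_le_pos; [apply Rabs_pos | lra].
  - apply Rmult_le_pos; [apply Rabs_pos | lra].
  - apply Rmult_le_compat_r; [lra | apply Rabs_pochhammer_le].
  - apply pochhammer_quotient_le.
Qed.

(** Successive coefficients have ratio [(1 + (b - 1) / (n + 1))^2], which tends to 1, so the radius
    of convergence is 1. *)
Lemma ex_series_hyp_coef_pow (b x : R) : 0 < b -> 0 <= x < 1 ->
  ex_series (fun n => hyp_coef b b 1 n * x ^ n).
Proof.
  intros Hb Hx. apply ex_series_Rabs, CV_disk_inside.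
  assert (Hpos : forall n, 0 < hyp_coef b b 1 n).
  { intros n. unfold hyp_coef. assert (P := pochhammer_pos b n Hb).
    assert (P1 := pochhammer_pos 1 n ltac:(lra)). assert (F := INR_fact_lt_0 n).
    apply Rdiv_lt_0_compat; now apply Rmult_lt_0_compat. }
  rewrite (CV_radius_finite_DAlembert _ 1).
  - rewrite Rabs_pos_eq by lra. simpl. lra.
  - intros n E. specialize (Hpos n). lra.
  - lra.
  - apply (is_lim_seq_ext (fun n => (1 + (b - 1) * / (INR n + 1))
        * (1 + (b - 1) * / (INR n + 1)))).
    + intros n. assert (H := Hpos n). assert (H' := Hpos (S n)).
      assert (N := pos_INR n).
      rewrite Rabs_pos_eq by (apply Rlt_le, Rdiv_lt_0_compat; assumption).
      assert (E := hyp_coef_S b b 1 n ltac:(lra)).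
      replace (hyp_coef b b 1 (S n)) with
        (hyp_coef b b 1 n * ((b + INR n) * (b + INR n) / (1 + INR n)) / (INR n + 1)).
      2:{ rewrite <- E. field. lra. }
      field. lra.
    + replace (Finite 1) with (Finite (1 * 1)) by (f_equal; ring).
      apply is_lim_seq_mult'; apply is_lim_seq_shift_div.
Qed.

Lemma hypergeom_uniform_bound (b x : R) : 0 <= x < 1 ->
  exists W, 0 <= W /\ forall k : nat,
    Rabs (hypergeom b (INR k + b) (INR k + 1) x) <= W.
Proof.
  intros Hx.
  assert (Hex := ex_series_hyp_coef_pow (1 + Rabs b) x
    ltac:(assert (A := Rabs_pos b); lra) Hx).
  exists (Series (fun n => hyp_coef (1 + Rabs b) (1 + Rabs b) 1 n * x ^ n)).
  assert (Hk : forall k : nat, Rabs (hypergeom b (INR k + b) (INR k + 1) x)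
    <= Series (fun n => hyp_coef (1 + Rabs b) (1 + Rabs b) 1 n * x ^ n)).
  { intros k.
    assert (Hb : forall n, Rabs (hyp_coef b (INR k + b) (INR k + 1) n * x ^ n)
               <= hyp_coef (1 + Rabs b) (1 + Rabs b) 1 n * x ^ n).
    { intros n. rewrite Rabs_mult, (Rabs_pos_eq (x ^ n)) by (apply pow_le; lra).
      apply Rmult_le_compat_r; [apply pow_le; lra | apply hyp_coef_dominated]. }
    apply Rle_trans with
      (Series (fun n => Rabs (hyp_coef b (INR k + b) (INR k + 1) n * x ^ n))).
    - apply Series_Rabs.
      refine (ex_series_le (V := R_CompleteNormedModule) _ _ _ Hex).
      intros n. unfold norm; simpl; unfold abs; simpl. rewrite Rabs_Rabsolu. apply Hb.
    - apply Series_le; [|exact Hex]. intros n. split; [apply Rabs_pos | apply Hb]. }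
  split; [|exact Hk]. apply Rle_trans with (2 := Hk O). apply Rabs_pos.
Qed.

Lemma limsup_coef_bound (c : Z -> C) (q : R) :
  Rbar_le (LimSup_Z (fun k : Z => nth_root (IZR (Z.abs k)) (Cmod (c k)))) 1 ->
  1 < q ->
  exists N : nat, forall k : Z, (Z.of_nat N <= Z.abs k)%Z ->
    Cmod (c k) <= q ^ Z.abs_nat k.
Proof.
  intros Hc Hq. set (u := fun k : Z => nth_root (IZR (Z.abs k)) (Cmod (c k))) in *.
  assert (HN : exists N : nat, Rbar_lt
    (Lub_Rbar (fun x => exists k : Z, (Z.of_nat N <= Z.abs k)%Z /\ x = u k)) q).
  { unfold LimSup_Z in Hc.
    assert (HI := Inf_seq_correct (fun n : nat =>
      Lub_Rbar (fun x => exists k : Z, (Z.of_nat n <= Z.abs k)%Z /\ x = u k))).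
    destruct (Inf_seq _) as [l| |]; simpl in Hc, HI; [|contradiction|].
    - assert (E : 0 < q - l) by lra.
      destruct (proj2 (HI (mkposreal _ E))) as [N HN]. exists N.
      simpl in HN. replace (l + (q - l)) with q in HN by ring. exact HN.
    - apply (HI q). }
  (* Taking [S N] rather than [N] excludes [k = 0], for which the exponent [1 / |k|] is
     meaningless. *)
  destruct HN as [N HN]. exists (S N). intros k Hk.
  assert (Huk : u k < q).
  { assert (HL := proj1 (Lub_Rbar_correct (fun x => exists k : Z,
      (Z.of_nat N <= Z.abs k)%Z /\ x = u k)) (u k)
      ltac:(exists k; split; [lia|reflexivity])).
    exact (Rbar_le_lt_trans _ _ _ HL HN). }
  unfold u, nth_root in Huk. destruct (Req_EM_T (Cmod (c k)) 0) as [Z|Z].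
  - rewrite Z. apply pow_le. lra.
  - assert (P : 0 < Cmod (c k)) by (assert (X := Cmod_ge_0 (c k)); lra).
    assert (K : 0 < INR (Z.abs_nat k)) by (apply lt_0_INR; lia).
    assert (E : IZR (Z.abs k) = INR (Z.abs_nat k)).
    { rewrite INR_IZR_INZ. f_equal. lia. }
    rewrite E in Huk.
    rewrite <- Rpower_pow by lra.
    replace (Cmod (c k)) with
      (Rpower (Rpower (Cmod (c k)) (/ INR (Z.abs_nat k))) (INR (Z.abs_nat k))).
    2:{ rewrite Rpower_mult, Rinv_l, Rpower_1; lra. }
    apply Rle_Rpower_l; [lra|]. split; [apply exp_pos | lra].
Qed.

Lemma Cpow_polar (r t : R) (n : nat) :
  Cpow (RtoC r * Cexp_i t) n = (RtoC (r ^ n) * Cexp_i (INR n * t))%C.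
Proof.
  induction n as [|n IH].
  - simpl. rewrite Rmult_0_l. unfold Cexp_i. rewrite cos_0, sin_0.
    unfold Cmult, RtoC; simpl. f_equal; ring.
  - rewrite Cpow_S, IH, S_INR, Rmult_plus_distr_r, Rmult_1_l.
    unfold Cexp_i. rewrite cos_plus, sin_plus.
    unfold Cmult, RtoC; simpl. f_equal; ring.
Qed.

Lemma Cmod_polar (r t : R) : 0 <= r -> Cmod (RtoC r * Cexp_i t) = r.
Proof.
  intros Hr. rewrite Cmod_mult, Cmod_R, Cmod_Cexp_i, Rabs_pos_eq by exact Hr. ring.
Qed.

Lemma coef_le_on_circle (alpha M r : R) (f : C -> C) (c : Z -> C) (k : nat) :
  Rbar_le (LimSup_Z (fun k : Z => nth_root (IZR (Z.abs k)) (Cmod (c k)))) 1 ->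
  (forall z : C, unit_disk z -> expansion_at alpha c f z) ->
  (forall z : C, unit_disk z -> Cmod (f z) <= M) ->
  (1 <= k)%nat -> 0 < r < 1 ->
  (Cmod (c (Z.of_nat k)) + Cmod (c (- Z.of_nat k)%Z))
    * Rabs (hypergeom (- alpha / 2) (INR k - alpha / 2) (INR k + 1) (r ^ 2)) * r ^ k
  <= 4 * M / PI.
Proof.
  intros Hc Hexp HM Hk Hr.
  set (F := fun j : nat =>
    hypergeom (- alpha / 2) (INR j - alpha / 2) (INR j + 1) (r ^ 2)).
  set (A := fun j : nat => (c (Z.of_nat j) * RtoC (F j * r ^ j))%C).
  (* The constant term belongs to [A]. *)
  set (B := fun j : nat => match j with
    | O => RtoC 0
    | S _ => (c (- Z.of_nat j)%Z * RtoC (F j * r ^ j))%C end).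
  assert (Hmod : forall w j, Cmod (w * RtoC (F j * r ^ j)) = Cmod w * Rabs (F j) * r ^ j).
  { intros w j. rewrite Cmod_mult, Cmod_R, Rabs_mult.
    rewrite (Rabs_pos_eq (r ^ j)) by (apply pow_le; lra). ring. }
  replace ((Cmod (c (Z.of_nat k)) + Cmod (c (- Z.of_nat k)%Z)) * _ * r ^ k)
    with (Cmod (A k) + Cmod (B k)).
  2:{ destruct k as [|k]; [lia|]. unfold A, B. rewrite !Hmod. unfold F. ring. }
  apply fourier_pair_le; [exact Hk| |].
  - destruct (hypergeom_uniform_bound (- alpha / 2) (r ^ 2)) as [W [HW0 HW]]; [nra|].
    (* Any [q] strictly between 1 and [1 / r] would do: [q > 1] makes the upper-limit bound
       applicable and [q r < 1] gives a geometric majorant. *)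
    set (q := 2 / (1 + r)).
    assert (Hq : 1 < q).
    { unfold q. apply Rmult_lt_reg_r with (1 + r); [lra|].
      replace (2 / (1 + r) * (1 + r)) with 2 by (field; lra). lra. }
    assert (Hqr : 0 <= q * r < 1).
    { split; [apply Rmult_le_pos; lra|]. unfold q.
      apply Rmult_lt_reg_r with (1 + r); [lra|].
      replace (2 / (1 + r) * r * (1 + r)) with (2 * r) by (field; lra). lra. }
    destruct (limsup_coef_bound c q Hc Hq) as [N HN].
    apply (ex_series_incr_n _ N).
    apply (ex_series_le (V := R_CompleteNormedModule) _
      (fun j => 2 * W * (q * r) ^ N * (q * r) ^ j)).
    2:{ apply (ex_series_scal_l (2 * W * (q * r) ^ N) (fun j => (q * r) ^ j)).
        apply ex_series_geom. rewrite Rabs_pos_eq; lra. }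
    intros j.
    assert (G : forall w, Cmod w <= q ^ (N + j) ->
       Cmod (w * RtoC (F (N + j)%nat * r ^ (N + j))) <= W * (q * r) ^ N * (q * r) ^ j).
    { intros w Hw. rewrite Hmod, !Rmult_assoc, <- (pow_add (q * r)), Rpow_mult_distr.
      assert (FW : Rabs (F (N + j)%nat) <= W).
      { unfold F. replace (INR (N + j) - alpha / 2) with (INR (N + j) + - alpha / 2)
          by field. apply HW. }
      assert (R0 : 0 <= r ^ (N + j)) by (apply pow_le; lra).
      replace (W * (q ^ (N + j) * r ^ (N + j))) with (q ^ (N + j) * (W * r ^ (N + j)))
        by ring.
      apply Rmult_le_compat; [apply Cmod_ge_0 | | exact Hw |].
      - apply Rmult_le_pos; [apply Rabs_pos | exact R0].
      - apply Rmult_le_compat_r; assumption. }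
    assert (GA : Cmod (A (N + j)%nat) <= W * (q * r) ^ N * (q * r) ^ j).
    { apply G. assert (X := HN (Z.of_nat (N + j)) ltac:(lia)).
      replace (Z.abs_nat (Z.of_nat (N + j))) with (N + j)%nat in X by lia. exact X. }
    assert (GB : Cmod (B (N + j)%nat) <= W * (q * r) ^ N * (q * r) ^ j).
    { unfold B. assert (X := HN (- Z.of_nat (N + j))%Z ltac:(lia)).
      replace (Z.abs_nat (- Z.of_nat (N + j))) with (N + j)%nat in X by lia.
      apply G in X. destruct (N + j)%nat; [|exact X].
      rewrite Cmod_0. repeat apply Rmult_le_pos; try apply pow_le; lra. }
    unfold norm; simpl; unfold abs; simpl.
    rewrite Rabs_pos_eq by (apply Rplus_le_le_0_compat; apply Cmod_ge_0). lra.
  - intros t. set (z := (RtoC r * Cexp_i t)%C).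
    assert (Hz : Cmod z = r) by (apply Cmod_polar; lra).
    assert (Hzd : unit_disk z) by (unfold unit_disk; lra).
    destruct (Hexp z Hzd) as (S1 & S2 & H1 & H2 & H3).
    exists S1, S2. split; [|split].
    + apply (is_series_ext) with (2 := H1).
      intros j. unfold A, F, z, F_alpha. fold z. rewrite Hz. unfold z.
      rewrite Cpow_polar, !RtoC_mult.
      match goal with |- @eq _ ?u ?v => change (@eq C u v) end. ring.
    (* The second sum of the expansion starts at [k = 1]; prepending [B 0 = 0] reindexes it from 0
       without changing its value. *)
    + apply (is_series_decr_1 (K := C_AbsRing) (V := C_NormedModule)).
      replace (plus S2 _) with S2.
      2:{ simpl. change (S2 = S2 + - (RtoC 0 * Cexp_i (- (0 * t))))%C. ring. }
      apply (is_series_ext) with (2 := H2).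
      intros j. unfold B, F, F_alpha. rewrite Hz.
      rewrite <- Cpow_conj. unfold z. rewrite Cpow_polar, Cmult_conj.
      replace (Cconj (Cexp_i (INR (S j) * t))) with (Cexp_i (- (INR (S j) * t)))
        by (unfold Cexp_i, Cconj; rewrite cos_neg, sin_neg; reflexivity).
      replace (Cconj (RtoC (r ^ S j))) with (RtoC (r ^ S j))
        by (unfold Cconj, RtoC; simpl; f_equal; ring).
      rewrite !RtoC_mult.
      match goal with |- @eq _ ?u ?v => change (@eq C u v) end. ring.
    + rewrite <- H3. apply HM, Hzd.
Qed.

Lemma hypergeom_lim_1 (a b c : R) (x : nat -> R) :
  0 < c -> 0 < c - a -> 0 < c - b -> 0 < c - a - b ->
  (forall m, 0 <= x m <= 1) -> is_lim_seq x 1 ->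
  is_lim_seq (fun m => hypergeom a b c (x m))
    (Gamma c * Gamma (c - a - b) / (Gamma (c - a) * Gamma (c - b))).
Proof.
  intros Hc Ha Hb Hd Hx Hlim. rewrite <- gauss_summation by assumption.
  apply PSeries_lim_1; try assumption. now apply ex_series_hyp_coef.
Qed.

Theorem corollary1p1
  (alpha M : R) (f : C -> C) (fstar : distribution) (c : Z -> C)
  (Halpha : -1 < alpha) (HM : 0 < M)
  (HfC2 : Cn_on unit_disk 2 f)
  (Hf : Dirichlet_solution alpha f fstar)
  (Hc : Rbar_le
          (LimSup_Z (fun k : Z => nth_root (IZR (Z.abs k)) (Cmod (c k)))) 1)
  (Hexp : forall z : C, unit_disk z -> expansion_at alpha c f z)
  (Hbound : Rbar_le
              (Lub_Rbar (fun x => exists z : C, unit_disk z /\ x = Cmod (f z)))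
              M) :
  forall k : nat, (1 <= k)%nat ->
    Cmod (c (Z.of_nat k)) + Cmod (c (- Z.of_nat k)%Z)
    <= 4 * M * Gamma (1 + alpha / 2) * Gamma (INR k + 1 + alpha / 2)
       / (INR (fact k) * Gamma (alpha + 1) * PI).
Proof.
  intros k Hk. assert (HPI := PI_RGT_0). assert (Hk0 := pos_INR k).
  assert (HM' : forall z : C, unit_disk z -> Cmod (f z) <= M).
  { intros z Hz.
    exact (Rbar_le_trans _ _ _ (proj1 (Lub_Rbar_correct _) (Cmod (f z))
      (ex_intro _ z (conj Hz eq_refl))) Hbound). }
  set (s := Cmod (c (Z.of_nat k)) + Cmod (c (- Z.of_nat k)%Z)).
  (* The radii are [1 - 1 / (2 (n + 1))]; the factor [1 / 2] keeps [r 0] positive. *)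
  set (r := fun n : nat => 1 + - (1 / 2) * / (INR n + 1)).
  assert (Hr : forall n, 0 < r n < 1).
  { intros n. unfold r. assert (B := gamma_trunc_bounds n). lra. }
  assert (Lr : is_lim_seq r 1) by apply is_lim_seq_shift_div.
  assert (Lpow : forall m, is_lim_seq (fun n => r n ^ m) 1).
  { intros m. rewrite <- (pow1 m).
    apply (is_lim_seq_continuous (fun y => y ^ m)); [|exact Lr].
    apply derivable_continuous_pt, derivable_pt_pow. }
  assert (G1 := Gamma_pos (1 + alpha / 2) ltac:(lra)).
  assert (G2 := Gamma_pos (INR k + 1 + alpha / 2) ltac:(lra)).
  assert (G3 := Gamma_pos (alpha + 1) ltac:(lra)).
  assert (Fk := INR_fact_lt_0 k).
  (* With [a = - alpha / 2], [b = k - alpha / 2] and [c = k + 1], the positivity conditions concern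
     [k + 1], [k + 1 + alpha / 2], [1 + alpha / 2] and [alpha + 1]. *)
  assert (LF := hypergeom_lim_1 (- alpha / 2) (INR k - alpha / 2) (INR k + 1)
    (fun n => r n ^ 2) ltac:(lra) ltac:(lra) ltac:(lra) ltac:(lra)
    ltac:(intros n; specialize (Hr n); nra) (Lpow 2%nat)).
  replace (INR k + 1 - - alpha / 2 - (INR k - alpha / 2)) with (alpha + 1) in LF by field.
  replace (INR k + 1 - - alpha / 2) with (INR k + 1 + alpha / 2) in LF by field.
  replace (INR k + 1 - (INR k - alpha / 2)) with (1 + alpha / 2) in LF by field.
  rewrite Gamma_fact in LF.
  set (L := INR (fact k) * Gamma (alpha + 1)
            / (Gamma (INR k + 1 + alpha / 2) * Gamma (1 + alpha / 2))) in *.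
  assert (HL : 0 < L) by (unfold L; apply Rdiv_lt_0_compat; now apply Rmult_lt_0_compat).
  (* The positivity of [L] identifies the limit of [|F_k(r^2)|] with [L] itself; the factor 1 is the
     limit of [r^k]. Dividing by [L] then gives the bound. *)
  assert (Hlim : s * L * 1 <= 4 * M / PI).
  { refine (is_lim_seq_le _ _ (s * L * 1) (4 * M / PI)
      (fun n => coef_le_on_circle alpha M (r n) f c k Hc Hexp HM' Hk (Hr n)) _ _).
    - apply is_lim_seq_mult'; [|apply Lpow]. fold s.
      apply (is_lim_seq_scal_l _ s L).
      rewrite <- (Rabs_pos_eq L) by lra. apply (is_lim_seq_abs _ L), LF.
    - apply is_lim_seq_const. }
  apply Rmult_le_reg_r with L; [exact HL|]. rewrite <- (Rmult_1_r (s * L)).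
  apply Rle_trans with (1 := Hlim). apply Req_le. unfold L. field.
  repeat split; lra.
Qed.
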